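(* Let $X$ be a Banach space, let $Y$ be an $M$-embedded Banach space, and let $G\in L(X,Y)$ be a norm-one operator. If $G$ has the alternative Daugavet property, then $G^*$ is lush. Therefore, the following nine assertions are equivalent: $G$ has the alternative Daugavet property; $G$ is a spear operator; $G$ is lush; $G^*$ has the alternative Daugavet property; $G^*$ is a spear operator; $G^*$ is lush; $G^{**}$ has the alternative Daugavet property; $G^{**}$ is a spear operator; $G^{**}$ is lush.
   Context: Scalars are $\mathbb{K}=\mathbb{R}$ or $\mathbb{C}$; $\mathbb{T}=\{\omega\in\mathbb{K}:|\omega|=1\}$; $B_X$, $S_X$ are the closed unit ball and unit sphere; $\operatorname{aconv}(F)=\operatorname{conv}(\mathbb{T}F)$. A Banach space $Y$ is $M$-embedded if $J_Y(Y)^\perp$ is an $L$-summand in $Y^{***}$, where $J_Y:Y\to Y^{**}$ is the canonical inclusion; i.e. $Y^{***}=J_Y(Y)^\perp\oplus_1 W$ ($\ell_1$-sum) for some closed subspace $W$. $G\in L(X,Y)$ is a spear operator if $\sup_{\omega\in\mathbb{T}}\|G+\omega T\|=1+\|T\|$ for every $T\in L(X,Y)$; it has the alternative Daugavet property if this holds for every rank-one $T\in L(X,Y)$. A norm-one $G\in L(X,Y)$ is lush if for every $x_0\in B_X$, $\varepsilon>0$ and $y\in S_Y$ there is $F\subset B_X$ with $\operatorname{conv}(F)\subset\{x\in B_X:\|Gx+y\|>2-\varepsilon\}$ and $\operatorname{dist}(x_0,\operatorname{aconv}(F))<\varepsilon$. *)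

(* Defs.v *)
From HB Require Import structures.
From mathcomp Require Import all_boot all_order all_algebra.
From mathcomp Require Import boolp classical_sets functions reals ereal.
From mathcomp Require Import topology convex normedtype.
From mathcomp.real_closed Require Import complex.

Set Implicit Arguments.
Unset Strict Implicit.
Unset Printing Implicit Defensive.

Import Order.TTheory GRing.Theory Num.Theory.
Import numFieldNormedType.Exports.

Local Open Scope classical_set_scope.
Local Open Scope ring_scope.

Variant scalar_kind := RealScalars | ComplexScalars.

Definition scalars (R : realType) (k : scalar_kind) : numFieldType :=
  match k with RealScalars => R | ComplexScalars => R[i] end.

Definition real_part (R : realType) (k : scalar_kind) : scalars R k -> R :=
  match k with
  | RealScalars => fun x => x
  | ComplexScalars => fun x => complex.Re x
  end.

Definition of_real (R : realType) (k : scalar_kind) : R -> scalars R k :=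
  match k with
  | RealScalars => fun x => x
  | ComplexScalars => fun x => Complex x 0
  end.
Arguments of_real {R} k _.

Section scalars_theory.
Context (R : realType) (k : scalar_kind).
Local Notation K := (scalars R k).
Implicit Types (z w : K) (r s : R).

Lemma of_realK r : real_part (of_real k r) = r.
Proof. by case: k. Qed.

Lemma real_partK z : z \is Num.real -> of_real k (real_part z) = z.
Proof.
case: k z => //= -[a b]; rewrite realE !lecE /=.
by case/orP => /andP[/eqP <-].
Qed.

Lemma real_part_le z w : z <= w -> real_part z <= real_part w.
Proof. by case: k z w => //= -[a b] [c d]; rewrite lecE => /andP[]. Qed.

Lemma of_real_le r s : (of_real k r <= of_real k s) = (r <= s).
Proof. by case: k => //=; rewrite lecE eqxx. Qed.

Lemma of_realD r s : of_real k (r + s) = of_real k r + of_real k s.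
Proof. by case: k => //=; exact: (rmorphD (real_complex R)). Qed.

Lemma of_realM r s : of_real k (r * s) = of_real k r * of_real k s.
Proof. by case: k => //=; exact: (rmorphM (real_complex R)). Qed.

Lemma of_real0 : of_real k (0 : R) = 0.
Proof. by case: k. Qed.

Lemma of_real1 : of_real k (1 : R) = 1.
Proof. by case: k. Qed.

Lemma of_real_inj : injective (@of_real R k).
Proof. exact: (can_inj of_realK). Qed.

End scalars_theory.

(* The norm of a normed space over K takes its values in K; rnorm is the same
   norm as a number of R. *)
Definition rnorm (R : realType) (k : scalar_kind)
  (X : normedModType (scalars R k)) (x : X) : R := real_part `|x|.

Section rnorm_theory.
Context (R : realType) (k : scalar_kind) (X : normedModType (scalars R k)).
Implicit Types x y : X.

Lemma rnormE x : of_real k (rnorm x) = `|x|.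
Proof. by rewrite real_partK// ger0_real. Qed.

Lemma rnorm_ge0 x : 0 <= rnorm x.
Proof. by rewrite -(of_real_le k) rnormE of_real0. Qed.

Lemma rnorm0 : rnorm (0 : X) = 0.
Proof. by apply: (@of_real_inj R k); rewrite rnormE normr0 of_real0. Qed.

Lemma rnorm_eq0 x : rnorm x = 0 -> x = 0.
Proof. by move=> x0; apply/normr0_eq0; rewrite -rnormE x0 of_real0. Qed.

Lemma ler_rnormD x y : rnorm (x + y) <= rnorm x + rnorm y.
Proof. by rewrite -(of_real_le k) of_realD !rnormE ler_normD. Qed.

End rnorm_theory.

Section rnorm_scale.
Context (R : realType) (k : scalar_kind) (X : normedModType (scalars R k)).

Lemma rnormZ (a : scalars R k) (x : X) :
  rnorm (a *: x) = rnorm (a : (scalars R k)^o) * rnorm x.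
Proof.
by apply: (@of_real_inj R k); rewrite of_realM !rnormE normrZ.
Qed.

Lemma rnorm_of_real (r : R) : 0 <= r ->
  rnorm (of_real k r : (scalars R k)^o) = r.
Proof.
move=> r0; apply: (@of_real_inj R k); rewrite rnormE ger0_norm//.
by rewrite -(of_real0 R k) of_real_le.
Qed.

End rnorm_scale.

Definition closed_unit_ball (R : realType) (k : scalar_kind)
  (X : normedModType (scalars R k)) : set X := [set x | rnorm x <= 1].

Definition unit_sphere (R : realType) (k : scalar_kind)
  (X : normedModType (scalars R k)) : set X := [set x | rnorm x = 1].

Definition unit_scalars (R : realType) (k : scalar_kind) : set (scalars R k) :=
  [set w | `|w| = 1].
Arguments closed_unit_ball {R k} X.
Arguments unit_sphere {R k} X.
Arguments unit_scalars R k : clear implicits.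

Section bounded_operators.
Context (R : realType) (k : scalar_kind) (X Y : normedModType (scalars R k)).
Local Notation K := (scalars R k).

Definition continuous_linear : {pred X -> Y} :=
  mem [set f : X -> Y | linear f /\ continuous f].

Record operator := Operator {
  operator_fun :> X -> Y;
  _ : operator_fun \in continuous_linear }.

HB.instance Definition _ := [isSub for operator_fun].
HB.instance Definition _ := [Choice of operator by <:].

Lemma continuous_linearP (f : X -> Y) :
  reflect (linear f /\ continuous f) (f \in continuous_linear).
Proof. by apply: (iffP idP) => [/set_mem|/mem_set]. Qed.

Lemma continuous_linear_submod_closed : submod_closed continuous_linear.
Proof.
split.
  apply/continuous_linearP; split; last by move=> x; exact: cvg_cst.
  by move=> a u v /=; rewrite /GRing.zero/= scaler0 addr0.
move=> a f g /continuous_linearP[lf cf] /continuous_linearP[lg cg].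
apply/continuous_linearP; split.
  move=> b u v; rewrite !fctE lf lg !scalerDr !scalerA (mulrC a b).
  by rewrite addrACA.
move=> x; apply: cvgD; last exact: cg.
by apply: cvgZl_tmp; exact: cf.
Qed.

HB.instance Definition _ := GRing.isSubmodClosed.Build _ _ continuous_linear
  continuous_linear_submod_closed.
HB.instance Definition _ := [SubChoice_isSubLmodule of operator by <:].

Lemma operator_linear (f : operator) : linear f.
Proof. by case: f => f /= /continuous_linearP[]. Qed.

Lemma operator_continuous (f : operator) : continuous f.
Proof. by case: f => f /= /continuous_linearP[]. Qed.

HB.instance Definition _ (f : operator) :=
  GRing.isLinear.Build K X Y *:%R (operator_fun f) (operator_linear f).

Lemma operatorP (f g : operator) : f =1 g -> f = g.
Proof. by move=> fg; apply/val_inj/funext. Qed.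

Lemma operator_bounded (f : operator) :
  exists2 M : R, 0 <= M & forall x, rnorm (f x) <= M * rnorm x.
Proof.
have /linear_boundedP/pinfty_ex_gt0[M M0 fM] :=
  continuous_linear_bounded 0 (@operator_continuous f 0).
have MK : of_real k (real_part M) = M by rewrite real_partK ?gtr0_real.
exists (real_part M).
  by rewrite -(of_real_le k) MK of_real0 ltW.
by move=> x; rewrite -(of_real_le k) of_realM MK !rnormE; exact: fM.
Qed.

(* The operator norm, over the closed unit ball (not the unit sphere), so that
   the supremum is over a nonempty set even when X is trivial. *)
Definition opnorm (f : operator) : R :=
  sup [set rnorm (f x) | x in closed_unit_ball X].

Lemma opnorm_has_sup (f : operator) :
  has_sup [set rnorm (f x) | x in closed_unit_ball X].
Proof.
split; first by exists (rnorm (f 0)), 0 => //=; rewrite /closed_unit_ball/= rnorm0.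
have [M M0 fM] := operator_bounded f.
exists M => _ [x x1 <-]; apply: le_trans (fM x) _.
by rewrite -[leRHS]mulr1 ler_wpM2l.
Qed.

Lemma opnorm_ub (f : operator) x : rnorm x <= 1 -> rnorm (f x) <= opnorm f.
Proof. by move=> x1; apply: (sup_upper_bound (opnorm_has_sup f)); exists x. Qed.

Lemma opnorm_ge0 (f : operator) : 0 <= opnorm f.
Proof.
by apply: le_trans (rnorm_ge0 (f 0)) _; apply: opnorm_ub; rewrite rnorm0.
Qed.

Lemma opnorm_le (f : operator) (M : R) :
  (forall x, rnorm x <= 1 -> rnorm (f x) <= M) -> opnorm f <= M.
Proof.
by move=> fM; apply: ge_sup => [|_ [x x1 <-]];
  [case: (opnorm_has_sup f)|exact: fM].
Qed.

Lemma rnorm_operator (f : operator) x : rnorm (f x) <= opnorm f * rnorm x.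
Proof.
have [->|x0] := eqVneq x 0; first by rewrite linear0 !rnorm0 mulr0.
have xp : 0 < rnorm x.
  rewrite lt_neqAle rnorm_ge0 andbT eq_sym.
  by apply: contra_neq x0 => /rnorm_eq0.
rewrite -ler_pdivrMr// mulrC.
have xi : 0 <= (rnorm x)^-1 by rewrite invr_ge0 ltW.
rewrite -{1}(rnorm_of_real k xi) -rnormZ -linearZ; apply: opnorm_ub.
by rewrite rnormZ rnorm_of_real// mulVf// gt_eqF.
Qed.

Let nrm (f : operator) : K := of_real k (opnorm f).

Let nrmD f g : nrm (f + g) <= nrm f + nrm g.
Proof.
rewrite -of_realD of_real_le; apply: opnorm_le => x x1.
by apply: le_trans (ler_rnormD _ _) _; apply: lerD; exact: opnorm_ub.
Qed.

Let nrmZ (a : K) f : nrm (a *: f) = `|a| * nrm f.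
Proof.
rewrite -(rnormE (a : K^o)) -of_realM; congr of_real.
have le1 b g : opnorm (b *: g) <= rnorm (b : K^o) * opnorm g.
  apply: opnorm_le => x x1; rewrite [X in rnorm X](_ : _ = b *: g x)//.
  by rewrite rnormZ ler_wpM2l ?rnorm_ge0// opnorm_ub.
apply/eqP; rewrite eq_le le1/=.
have [->|a0] := eqVneq a 0.
  by rewrite rnorm0 mul0r opnorm_ge0.
have := le1 a^-1 (a *: f); rewrite scalerA mulVf// scale1r => h.
apply: le_trans (ler_wpM2l (rnorm_ge0 _) h) _.
rewrite mulrA -[X in X * _ <= _]rnormZ.
rewrite [X in rnorm X](_ : _ = 1); last exact: mulfV.
by rewrite -[X in rnorm X](of_real1 R k) rnorm_of_real// mul1r.
Qed.

Let nrm0_eq0 f : nrm f = 0 -> f = 0.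
Proof.
rewrite -(of_real0 R k) => /of_real_inj f0; apply/operatorP => x.
apply: rnorm_eq0; apply/eqP; rewrite eq_le rnorm_ge0 andbT.
by apply: le_trans (rnorm_operator f x) _; rewrite f0 mul0r.
Qed.

HB.instance Definition _ := @Lmodule_isNormed.Build K operator
  nrm nrmD nrmZ nrm0_eq0.

Lemma rnorm_opnorm (f : operator) : rnorm f = opnorm f.
Proof. by apply: (@of_real_inj R k); rewrite rnormE. Qed.

Lemma linear_bounded_operator (f : X -> Y) (M : R) : linear f ->
  (forall x, rnorm (f x) <= M * rnorm x) -> f \in continuous_linear.
Proof.
move=> lf fM; apply/continuous_linearP; split => //.
pose F : {linear X -> Y} := HB.pack f (GRing.isLinear.Build K X Y *:%R f lf).
apply: (@bounded_linear_continuous _ _ _ F); apply/ex_bound.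
exists (of_real k `|M|); apply/nbhs_norm0P; exists 1 => //= x /ltW x1.
rewrite /= -rnormE of_real_le (le_trans (fM x))//.
rewrite (le_trans (ler_wpM2r (rnorm_ge0 x) (ler_norm M)))//.
rewrite -[leRHS]mulr1 ler_wpM2l// -(of_real_le k) of_real1.
by rewrite [leLHS]rnormE.
Qed.

End bounded_operators.

Notation "''L' ( X , Y )" := (operator X Y)
  (at level 8, format "''L' ( X ,  Y )") : type_scope.

Definition dual (R : realType) (k : scalar_kind)
  (X : normedModType (scalars R k)) : normedModType (scalars R k) :=
  'L(X, (scalars R k)^o).

Section adjoint.
Context (R : realType) (k : scalar_kind) (X Y : normedModType (scalars R k)).
Local Notation K := (scalars R k).

Lemma comp_operator_subproof (G : 'L(X, Y)) (f : 'L(Y, K^o)) :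
  f \o G \in @continuous_linear R k X K^o.
Proof.
apply/continuous_linearP; split.
  by move=> a u v /=; rewrite linearP linearP.
by move=> x; apply: continuous_comp; exact: operator_continuous.
Qed.

Definition adjoint_fun (G : 'L(X, Y)) (f : dual Y) : dual X :=
  Operator (comp_operator_subproof G f).

Lemma adjoint_subproof (G : 'L(X, Y)) :
  adjoint_fun G \in @continuous_linear R k (dual Y) (dual X).
Proof.
apply: (@linear_bounded_operator _ _ _ _ _ (opnorm G)).
  by move=> a f g; exact/operatorP.
move=> f; rewrite rnorm_opnorm; apply: opnorm_le => x x1 /=.
apply: le_trans (rnorm_operator f (G x)) _.
rewrite mulrC rnorm_opnorm ler_wpM2r ?opnorm_ge0//.
exact: opnorm_ub.
Qed.

Definition adjoint (G : 'L(X, Y)) : 'L(dual Y, dual X) :=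
  Operator (adjoint_subproof G).

Lemma adjointE (G : 'L(X, Y)) (f : dual Y) (x : X) :
  (adjoint G f : 'L(X, K^o)) x = (f : 'L(Y, K^o)) (G x).
Proof. by []. Qed.

End adjoint.

Section canonical_inclusion.
Context (R : realType) (k : scalar_kind) (X : normedModType (scalars R k)).
Local Notation K := (scalars R k).

Lemma evaluation_subproof (x : X) :
  (fun f : dual X => f x) \in @continuous_linear R k (dual X) K^o.
Proof.
apply: (@linear_bounded_operator _ _ _ _ _ (rnorm x)) => // f.
by rewrite mulrC rnorm_opnorm rnorm_operator.
Qed.

Definition canonical_inclusion_fun (x : X) : dual (dual X) :=
  Operator (evaluation_subproof x).

Lemma canonical_inclusion_subproof :
  canonical_inclusion_fun \in @continuous_linear R k X (dual (dual X)).
Proof.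
apply: (@linear_bounded_operator _ _ _ _ _ 1).
  by move=> a x y; apply/operatorP => f /=; rewrite linearP.
move=> x; rewrite mul1r rnorm_opnorm; apply: opnorm_le => f f1 /=.
apply: le_trans (rnorm_operator f x) _.
by rewrite -rnorm_opnorm -[leRHS]mul1r ler_wpM2r ?rnorm_ge0.
Qed.

Definition canonical_inclusion : 'L(X, dual (dual X)) :=
  Operator canonical_inclusion_subproof.

End canonical_inclusion.
Arguments canonical_inclusion {R k} X.

Section geometry.
Context (R : realType) (k : scalar_kind) (X : normedModType (scalars R k)).
Local Notation K := (scalars R k).

Definition annihilator (A : set X) : set (dual X) :=
  [set f : dual X | forall x, A x -> f x = 0].

Definition closed_subspace (A : set X) : Prop :=
  [/\ closed A, A 0 & forall (a : K) x y, A x -> A y -> A (a *: x + y)].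

Definition l1_direct_sum (A W : set X) : Prop :=
  [/\ forall x, exists a w, [/\ A a, W w & x = a + w],
      A `&` W = [set 0]
    & forall a w, A a -> W w -> rnorm (a + w) = rnorm a + rnorm w].

Definition L_summand (A : set X) : Prop :=
  closed_subspace A /\
  exists W : set X, closed_subspace W /\ l1_direct_sum A W.

(* Real convex combinations: {i01 K} consists of the t in K with 0 <= t <= 1,
   and for the order of R[i] such a t is real. *)
Definition convex_hull (F : set X) : set X :=
  smallest (@convex_set K X) F.

Definition aconv (F : set X) : set X :=
  convex_hull [set w *: x | w in unit_scalars R k & x in F].

(* Infinite when A is empty. *)
Definition dist (x : X) (A : set X) : \bar R :=
  ereal_inf [set (rnorm (x - a))%:E | a in A].

End geometry.

Definition M_embedded (R : realType) (k : scalar_kind)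
  (Y : normedModType (scalars R k)) : Prop :=
  L_summand (annihilator (range (canonical_inclusion Y))).

Section operators.
Context (R : realType) (k : scalar_kind) (X Y : normedModType (scalars R k)).
Local Notation K := (scalars R k).

Definition rank_one (T : 'L(X, Y)) : Prop :=
  exists2 y : Y, y != 0 & range T = range (fun a : K => a *: y).

Definition spear_equation (G T : 'L(X, Y)) : Prop :=
  sup [set rnorm (G + w *: T) | w in unit_scalars R k] = 1 + rnorm T.

Definition spear (G : 'L(X, Y)) : Prop := forall T, spear_equation G T.

Definition alternative_Daugavet (G : 'L(X, Y)) : Prop :=
  forall T, rank_one T -> spear_equation G T.

Definition lush (G : 'L(X, Y)) : Prop :=
  rnorm G = 1 /\
  forall (x0 : X) (e : R) (y : Y),
    closed_unit_ball X x0 -> 0 < e -> unit_sphere Y y ->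
    exists F : set X,
      [/\ F `<=` closed_unit_ball X,
          convex_hull F `<=`
            [set x | closed_unit_ball X x /\ rnorm (G x + y) > 2 - e]
        & (dist x0 (aconv F) < e%:E)%E].

End operators.

(* Main.v *)
(* Restriction to [Y] sends [f] in [Y***] to [g] in [Y*], and since [Y] is
   M-embedded [|f| = |f - g| + |g|], so norm-preserving extensions from [Y] to
   [Y**] are unique.  By Hahn-Banach, a convex subset of the ball of [Y*] that
   norms a real subspace [S] of [Y] is then dense, for the norm of functionals
   restricted to [S], in the functionals attaining their norm on [S].

   For separable [S] this makes the functionals on [S] norm separable; a
   branching argument on nested balls, as for the Frechet differentiability of
   convex functions on Asplund spaces, then shows that the ball of [Y*] has
   weak* slices of arbitrarily small diameter in every direction.  If [G] has the
   alternative Daugavet property and [z] lies in such a small slice, then [G^* z]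
   is almost a spear vector of [X*].  These [z] norm [Y], so for [S = Y] their
   convex hull is norm dense in the ball of [Y*]; from this [G], [G^*] and [G^**]
   are all lush.  Conversely lush operators are spears, and the alternative
   Daugavet property passes from an adjoint to the operator. *)

Require Import Defs.
From mathcomp Require Import all_boot all_order all_algebra.
From mathcomp Require Import boolp classical_sets functions reals ereal.
From mathcomp Require Import topology convex normedtype.
From mathcomp Require Import lra ring.
From mathcomp.real_closed Require Import complex.

Set Implicit Arguments.
Unset Strict Implicit.
Unset Printing Implicit Defensive.

Import Order.TTheory GRing.Theory Num.Theory.
Import numFieldNormedType.Exports.

Local Open Scope classical_set_scope.
Local Open Scope ring_scope.

(** * Scalars *)

Section scalars.
Context (R : realType) (k : scalar_kind).
Local Notation K := (scalars R k).
Implicit Types z w : K.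

Lemma of_realN (r : R) : of_real k (- r) = - of_real k r.
Proof. by apply/eqP; rewrite -addr_eq0 -of_realD addNr of_real0. Qed.

Lemma of_realB (r s : R) : of_real k (r - s) = of_real k r - of_real k s.
Proof. by rewrite of_realD of_realN. Qed.

Lemma of_real_lt (r s : R) : (of_real k r < of_real k s) = (r < s).
Proof. by rewrite !lt_neqAle of_real_le (inj_eq (@of_real_inj R k)). Qed.

Lemma real_partD z w : real_part (z + w) = real_part z + real_part w.
Proof. by case: k z w => //= -[a b] [c d]. Qed.

Lemma real_partZ (r : R) z : real_part (of_real k r * z) = r * real_part z.
Proof. by case: k z => //= -[a b] /=; rewrite mul0r subr0. Qed.

Lemma real_partN z : real_part (- z) = - real_part z.
Proof. by case: k z => //= -[a b]. Qed.

Lemma ler_norm_real_part z : `|real_part z| <= rnorm (z : K^o).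
Proof.
rewrite -(of_real_le k) rnormE; case: k z => [//|[a b]].
exact: (normc_ge_Re (Complex a b)).
Qed.

Lemma ler_real_part z : real_part z <= rnorm (z : K^o).
Proof. exact: le_trans (ler_norm _) (ler_norm_real_part z). Qed.

Lemma scalar_phase z : exists2 w, unit_scalars R k w & w * z = `|z|.
Proof.
have [->|z0] := eqVneq z 0.
  by exists 1; rewrite ?mulr0 ?normr0// /unit_scalars/= normr1.
exists (`|z| / z); last by rewrite divfK.
by rewrite /unit_scalars/= normrM normr_id normfV mulfV// normr_eq0.
Qed.

Lemma unit_scalarsV w : unit_scalars R k w -> unit_scalars R k w^-1.
Proof. by rewrite /unit_scalars /= normfV => ->; rewrite invr1. Qed.

Lemma unit_scalar_neq0 w : unit_scalars R k w -> w != 0.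
Proof. by rewrite /unit_scalars /= -normr_eq0 => ->; exact: oner_neq0. Qed.

Lemma unit_scalars1 : unit_scalars R k 1.
Proof. by rewrite /unit_scalars /= normr1. Qed.

Lemma unit_scalarsN w : unit_scalars R k w -> unit_scalars R k (- w).
Proof. by rewrite /unit_scalars /= normrN. Qed.

Lemma rnorm_unit_scalar w : unit_scalars R k w -> rnorm (w : K^o) = 1.
Proof.
by move=> w1; apply: (@of_real_inj R k); rewrite rnormE w1 of_real1.
Qed.

End scalars.

(** * Hahn-Banach theorem *)

Section hahn_banach.
Context (R : realType) (k : scalar_kind) (V : lmodType (scalars R k)).
Implicit Types (p q F : V -> R) (C : set (V * R)).

(** Only real scalars enter: a complex space is treated as a real one, and [real_part_linear]
    recovers the complex functional. *)
Definition sublinear p :=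
  (forall x y, p (x + y) <= p x + p y) /\
  (forall r x, 0 <= r -> p (of_real k r *: x) = r * p x).

Definition real_linear F :=
  (forall x y, F (x + y) = F x + F y) /\
  (forall r x, F (of_real k r *: x) = r * F x).

(** A pair [(x, r)] encodes a constraint [r <= F x] on the functional sought. *)
Definition convex_cone C :=
  [/\ C (0, 0),
      forall v w, C v -> C w -> C (v.1 + w.1, v.2 + w.2)
    & forall r v, 0 <= r -> C v -> C (of_real k r *: v.1, r * v.2)].

Lemma sublinear0 p : sublinear p -> p 0 = 0.
Proof.
by move=> [_ pZ]; rewrite -(scaler0 _ (of_real k 0)) pZ// mul0r.
Qed.

Lemma sublinearN p x : sublinear p -> - p (- x) <= p x.
Proof.
move=> sp; have := sp.1 x (- x); rewrite subrr sublinear0//; lra.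
Qed.

Lemma real_linear0 F : real_linear F -> F 0 = 0.
Proof. by move=> [_ FZ]; rewrite -(scaler0 _ (of_real k 0)) FZ mul0r. Qed.

Lemma real_linearN F x : real_linear F -> F (- x) = - F x.
Proof.
move=> fF; have := fF.1 x (- x); rewrite subrr real_linear0//; lra.
Qed.

Lemma real_linearB F x y : real_linear F -> F (x - y) = F x - F y.
Proof. by move=> fF; rewrite fF.1 real_linearN. Qed.

(** [q x] is the infimum of [p (x + v) - r] over [(v, r)] in [C], finite because [C] lies below [p].
    A linear [F] below [q] meets the constraints: [F (- v) <= q (- v) <= - r]. *)
Lemma sublinear_inf p C : sublinear p -> convex_cone C ->
    (forall v, C v -> v.2 <= p v.1) ->
  exists q, [/\ sublinear q, forall x, q x <= p x
              & forall v, C v -> q (- v.1) <= - v.2].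
Proof.
move=> sp [C0 CD CZ] Cp; have [pD pZ] := sp.
pose S x := [set p (x + v.1) - v.2 | v in C].
have Slb x : lbound (S x) (- p (- x)).
  move=> _ [v Cv <-]; have := Cp _ Cv.
  by have := pD (x + v.1) (- x); rewrite addrAC subrr add0r; lra.
have Si x : has_inf (S x).
  split; first by exists (p (x + 0) - 0), (0, 0).
  by exists (- p (- x)).
pose q x := inf (S x).
have qle x v : C v -> q x <= p (x + v.1) - v.2.
  by move=> Cv; apply: ge_inf; [exact: (Si x).2|exists v].
have qadh x e : 0 < e -> exists2 v, C v & p (x + v.1) - v.2 < q x + e.
  by move=> e0; have [_ [v Cv <-] h] := inf_adherent e0 (Si x); exists v.
have qp x : q x <= p x by have := qle x (0, 0) C0; rewrite addr0 subr0.
have qD x y : q (x + y) <= q x + q y.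
  apply/ler_addgt0Pr => e e0; have e20 : 0 < e / 2 by lra.
  have [v Cv hv] := qadh x _ e20; have [w Cw hw] := qadh y _ e20.
  have := qle (x + y) _ (CD _ _ Cv Cw); rewrite /= addrACA.
  by have := pD (x + v.1) (y + w.1); lra.
have qZ1 r x : 0 <= r -> q (of_real k r *: x) <= r * q x.
  move=> r0; apply/ler_addgt0Pr => e e0.
  have e20 : 0 < e / (r + 1) by rewrite divr_gt0//; lra.
  have [v Cv hv] := qadh x _ e20.
  have := qle (of_real k r *: x) _ (CZ _ _ r0 Cv).
  rewrite /= -scalerDr pZ// -mulrBr => /le_trans; apply.
  apply: le_trans (ler_wpM2l r0 (ltW hv)) _.
  rewrite mulrDr lerD2l mulrCA -[leRHS]mulr1 ler_wpM2l ?(ltW e0)//.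
  by rewrite ler_pdivrMr; lra.
have q0 : q 0 = 0.
  apply/eqP; rewrite eq_le; apply/andP; split.
    by rewrite (le_trans (qp 0))// (sublinear0 sp).
  apply: lb_le_inf => [|a /Slb]; first exact: (Si 0).1.
  by rewrite oppr0 (sublinear0 sp) oppr0.
exists q; split=> //.
  split=> // r x; rewrite le_eqVlt => /orP[/eqP<-|r0].
    by rewrite of_real0 scale0r mul0r q0.
  apply/eqP; rewrite eq_le (qZ1 _ _ (ltW r0))//=.
  have := @qZ1 r^-1 (of_real k r *: x).
  rewrite scalerA -of_realM mulVf ?gt_eqF// of_real1 scale1r => h.
  have ri : 0 < r^-1 by rewrite invr_gt0.
  by rewrite -(ler_pM2l ri) mulKf ?gt_eqF// h// ltW.
move=> v Cv; have := qle (- v.1) _ Cv.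
by rewrite addNr (sublinear0 sp) sub0r.
Qed.

(* A minimal sublinear functional is linear: minimality against the infimal
   convolution with the ray through [(x, q x)] gives [q (- x) = - q x]. *)
Lemma sublinear_dominates p : sublinear p ->
  exists2 F, real_linear F & forall x, F x <= p x.
Proof.
move=> sp; have [pD pZ] := sp.
pose T := {q : V -> R | sublinear q /\ forall x, q x <= p x}.
(* The order is reversed, so that a maximal element is a minimal sublinear functional. *)
pose rel (q1 q2 : T) := `[< forall x, sval q2 x <= sval q1 x >].
have [|||A Atot|[q [sq qp]] qmin] := @Zorn T rel.
- by move=> t; apply/asboolP.
- move=> r s t /asboolP rs /asboolP st; apply/asboolP => x.
  exact: le_trans (st x) (rs x).
- move=> [q1 h1] [q2 h2] /asboolP/= le21 /asboolP/= le12.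
  have q12 : q1 = q2 by apply/funext => x; apply/eqP; rewrite eq_le le12 le21.
  by case: q2 / q12 h2 {le21 le12} => h2; congr exist; exact: Prop_irrelevance.
(* A chain is bounded by its pointwise infimum, finite because each member is at least [- p (- x)]
   at [x]; the empty chain is bounded by [p]. *)
- have [[t0 At0]|A0] := pselect (A !=set0); last first.
    exists (exist _ p (conj sp (fun x => lexx _))) => s As.
    by exfalso; apply: A0; exists s.
  pose S x := [set sval t x | t in A].
  have Si x : has_inf (S x).
    split; first by exists (sval t0 x), t0.
    exists (- p (- x)) => _ [t At <-].
    have := sublinearN x (svalP t).1; have := (svalP t).2 (- x); lra.
  pose q x := inf (S x).
  have qle x t : A t -> q x <= sval t x.
    by move=> At; apply: ge_inf; [exact: (Si x).2|exists t].
  have qadh x e : 0 < e -> exists2 t, A t & sval t x < q x + e.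
    by move=> e0; have [_ [t At <-] h] := inf_adherent e0 (Si x); exists t.
  have sq : sublinear q.
    split=> [x y|r x r0].
      apply/ler_addgt0Pr => e e0; have e20 : 0 < e / 2 by lra.
      have [s As hs] := qadh x _ e20; have [t At ht] := qadh y _ e20.
      have [/asboolP st|/asboolP ts] := Atot _ _ As At.
        have := st x; have := (svalP t).1.1 x y; have := qle (x + y) _ At; lra.
      have := ts y; have := (svalP s).1.1 x y; have := qle (x + y) _ As; lra.
    apply/eqP; rewrite eq_le; apply/andP; split.
      apply/ler_addgt0Pr => e e0.
      have e20 : 0 < e / (r + 1) by rewrite divr_gt0//; lra.
      have [t At ht] := qadh x _ e20.
      apply: le_trans (qle _ _ At) _; rewrite (svalP t).1.2//.
      apply: le_trans (ler_wpM2l r0 (ltW ht)) _.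
      rewrite mulrDr lerD2l mulrCA -[leRHS]mulr1 ler_wpM2l ?(ltW e0)//.
      by rewrite ler_pdivrMr; lra.
    apply: lb_le_inf => [|_ [t At <-]]; first exact: (Si _).1.
    by rewrite (svalP t).1.2// ler_wpM2l// qle.
  have qp x : q x <= p x.
    exact: le_trans (qle x _ At0) ((svalP t0).2 x).
  exists (exist _ q (conj sq qp)) => s As; apply/asboolP => x /=.
  exact: qle.
- have qN x : q (- x) = - q x.
    pose C := [set v : V * R |
      exists2 r, 0 <= r & v = (of_real k r *: x, r * q x)].
    have CC : convex_cone C.
      split; first by exists 0; rewrite // of_real0 scale0r mul0r.
        move=> _ _ [r r0 ->] [s s0 ->]; exists (r + s); first exact: addr_ge0.
        by rewrite /= of_realD scalerDl mulrDl.
      move=> r _ r0 [s s0 ->]; exists (r * s); first exact: mulr_ge0.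
      by rewrite /= of_realM scalerA mulrA.
    have [|q' [sq' q'q q'C]] := sublinear_inf sq CC.
      by move=> _ [r r0 ->] /=; rewrite sq.2.
    have q'p y : q' y <= p y by exact: le_trans (q'q y) (qp y).
    pose t : T := exist _ q' (conj sq' q'p).
    have /(congr1 sval)/= qq' := qmin t (asboolT q'q).
    have Cx : C (x, q x) by exists 1; rewrite // of_real1 scale1r mul1r.
    have := q'C _ Cx; rewrite /= qq' => qNx.
    apply/eqP; rewrite eq_le qNx/=.
    by have := sublinearN (- x) sq; rewrite opprK; lra.
  exists q => //; split=> [x y|r x].
    apply/eqP; rewrite eq_le sq.1/=.
    by have := sq.1 (- x) (- y); rewrite -opprD !qN; lra.
  have [r0|r0] := leP 0 r; first exact: sq.2.
  have := sq.2 (- r) x; rewrite of_realN scaleNr qN => h.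
  by have := h _; lra.
Qed.

Lemma mazur_orlicz p C : sublinear p -> convex_cone C ->
    (forall v, C v -> v.2 <= p v.1) ->
  exists F, [/\ real_linear F, forall x, F x <= p x
              & forall v, C v -> v.2 <= F v.1].
Proof.
move=> sp CC Cp; have [q [sq qp qC]] := sublinear_inf sp CC Cp.
have [F fF Fq] := sublinear_dominates sq; exists F; split=> //.
  by move=> x; exact: le_trans (Fq x) (qp x).
by move=> v /qC; have := Fq (- v.1); rewrite real_linearN//; lra.
Qed.

Definition real_convex (A : set V) := forall (t : R) x y, 0 <= t <= 1 ->
  A x -> A y -> A (of_real k t *: x + of_real k (1 - t) *: y).

(** Mazur-Orlicz for the cone generated by the pairs [(a, r)] with [a] in [A]; homogeneity puts it
    below [p]. *)
Lemma sublinear_separation p (A : set V) (r : R) :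
    sublinear p -> real_convex A -> (forall a, A a -> r <= p a) ->
  exists F, [/\ real_linear F, forall x, F x <= p x & forall a, A a -> r <= F a].
Proof.
move=> sp cA Ap; have [[a0 Aa0]|A0] := pselect (A !=set0); last first.
  have [F lF Fp] := sublinear_dominates sp; exists F; split=> // a Aa.
  by exfalso; apply: A0; exists a.
pose C := [set v : V * R |
  exists t a, [/\ 0 <= t, A a & v = (of_real k t *: a, t * r)]].
have CC : convex_cone C.
  split.
  - by exists 0, a0; rewrite of_real0 scale0r mul0r.
  - move=> _ _ [s [a [s0 Aa ->]]] [t [b [t0 Ab ->]]] /=.
    exists (s + t); move: s0; rewrite le_eqVlt => /orP[/eqP<-|s0].
      by exists b; rewrite of_real0 scale0r mul0r !add0r.
    have st0 : 0 < s + t by lra.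
    exists (of_real k (s / (s + t)) *: a + of_real k (1 - s / (s + t)) *: b).
    split; first exact: ltW.
      apply: cA => //; rewrite divr_ge0 ?(ltW s0) ?(ltW st0)//=.
      by rewrite ler_pdivrMr// mul1r; lra.
    congr (_, _); last by rewrite mulrDl.
    rewrite scalerDr !scalerA -!of_realM.
    have -> : (s + t) * (s / (s + t)) = s by field; rewrite gt_eqF.
    by have -> : (s + t) * (1 - s / (s + t)) = t by field; rewrite gt_eqF.
  - move=> s _ s0 [t [a [t0 Aa ->]]]; exists (s * t), a.
    by rewrite mulr_ge0// of_realM scalerA mulrA.
have [|F [lF Fp FC]] := mazur_orlicz sp CC.
  by move=> _ [t [a [t0 Aa ->]]] /=; rewrite sp.2// ler_wpM2l// Ap.
exists F; split=> // a Aa; apply: (FC (a, r)); exists 1, a.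
by rewrite ler01 of_real1 scale1r mul1r.
Qed.

End hahn_banach.

(** In the complex case [f x = F x - i F (i x)]. *)
Lemma real_part_linear (R : realType) (k : scalar_kind)
    (V : lmodType (scalars R k)) (F : V -> R) : real_linear F ->
  exists2 f : V -> (scalars R k)^o, linear f & forall x, real_part (f x) = F x.
Proof.
case: k V F => /= V F [FD FZ].
  by exists F => // a x y; rewrite FD (FZ a).
pose I : R[i] := Complex 0 1.
have FI (x : V) : F (I *: (I *: x)) = - F x.
  rewrite scalerA (_ : I * I = Complex (-1) 0) ?(FZ (-1)) ?mulN1r//.
  apply/eqP; rewrite eq_complex /=.
  by rewrite !(mul0r, mul1r, mulr0, add0r, addr0, sub0r, oppr0) !eqxx.
exists (fun x => Complex (F x) (- F (I *: x))) => //.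
move=> [a b] x y.
have cE (z : V) : Complex a b *: z = Complex a 0 *: z + Complex b 0 *: (I *: z).
  rewrite scalerA -scalerDl; congr (_ *: _).
  apply/eqP; rewrite eq_complex /=.
  by rewrite !(mul0r, mul1r, mulr0, mulr1, add0r, addr0, subr0, sub0r, oppr0) !eqxx.
have IC c (z : V) : I *: (Complex c 0 *: z) = Complex c 0 *: (I *: z).
  by rewrite !scalerA mulrC.
apply/eqP; rewrite eq_complex /= scalerDr !cE scalerDr !IC !FD !(FZ a) !(FZ b) !FI.
by apply/andP; split; apply/eqP; ring.
Qed.

(** * Norms and real parts of functionals *)

Section rnorm_extra.
Context (R : realType) (k : scalar_kind) (X : normedModType (scalars R k)).
Implicit Types x y : X.

Lemma rnormZu w x : unit_scalars R k w -> rnorm (w *: x) = rnorm x.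
Proof. by move=> w1; rewrite rnormZ rnorm_unit_scalar// mul1r. Qed.

Lemma rnormN x : rnorm (- x) = rnorm x.
Proof. by rewrite /rnorm normrN. Qed.

Lemma rnormBC x y : rnorm (x - y) = rnorm (y - x).
Proof. by rewrite -rnormN opprB. Qed.

Lemma rnormZr (r : R) x : rnorm (of_real k r *: x) = `|r| * rnorm x.
Proof.
rewrite rnormZ; congr (_ * _).
have [r0|r0] := leP 0 r; first by rewrite rnorm_of_real// ger0_norm.
by rewrite /rnorm -normrN -of_realN [LHS]rnorm_of_real ?ltr0_norm ?oppr_ge0 ?ltW.
Qed.

Lemma ler_rnormB x y : rnorm x - rnorm y <= rnorm (x - y).
Proof. by have := ler_rnormD (x - y) y; rewrite subrK; lra. Qed.

Lemma sublinear_rnorm (M : R) : 0 <= M ->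
  sublinear (fun x : X => M * rnorm x).
Proof.
move=> M0; split=> [x y|r x r0].
  by rewrite -mulrDr ler_wpM2l// ler_rnormD.
by rewrite rnormZr ger0_norm// mulrCA.
Qed.

End rnorm_extra.

Section dual_real_part.
Context (R : realType) (k : scalar_kind) (X : normedModType (scalars R k)).
Local Notation K := (scalars R k).
Implicit Types (f g : dual X) (x y : X).

Definition dual_re (f : dual X) (x : X) : R := real_part ((f : 'L(X, K^o)) x).

Lemma dual_scale f (a : K) x :
  (f : 'L(X, K^o)) (a *: x) = a * (f : 'L(X, K^o)) x.
Proof. exact: linearZ. Qed.

Lemma dual_reDl f g x : dual_re (f + g) x = dual_re f x + dual_re g x.
Proof. by rewrite /dual_re -real_partD. Qed.

Lemma dual_re0l (x : X) : dual_re 0 x = 0.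
Proof. by have := dual_reDl 0 0 x; rewrite addr0; lra. Qed.

Lemma dual_reZl r f x : dual_re (of_real k r *: f) x = r * dual_re f x.
Proof. by rewrite /dual_re -real_partZ. Qed.

Lemma dual_reNl f x : dual_re (- f) x = - dual_re f x.
Proof. by rewrite /dual_re -real_partN. Qed.

Lemma dual_reBl f g x : dual_re (f - g) x = dual_re f x - dual_re g x.
Proof. by rewrite dual_reDl dual_reNl. Qed.

Lemma dual_re_linear f : real_linear (dual_re f).
Proof.
split=> [x y|r x]; rewrite /dual_re; first by rewrite linearD real_partD.
by rewrite linearZ /= real_partZ.
Qed.

Lemma dual_reDr f x y : dual_re f (x + y) = dual_re f x + dual_re f y.
Proof. exact: (dual_re_linear f).1. Qed.

Lemma dual_reZr r f x : dual_re f (of_real k r *: x) = r * dual_re f x.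
Proof. exact: (dual_re_linear f).2. Qed.

Lemma dual_reNr f x : dual_re f (- x) = - dual_re f x.
Proof. exact: real_linearN (dual_re_linear f). Qed.

Lemma dual_reBr f x y : dual_re f (x - y) = dual_re f x - dual_re f y.
Proof. exact: real_linearB (dual_re_linear f). Qed.

Lemma dual_re_scale (w : K) f x : dual_re (w *: f) x = dual_re f (w *: x).
Proof. by rewrite /dual_re linearZ. Qed.

Lemma dual_re_le f x : dual_re f x <= rnorm f * rnorm x.
Proof.
apply: le_trans (ler_real_part _) _.
by rewrite rnorm_opnorm; exact: rnorm_operator.
Qed.

Lemma dual_re_ball f x : rnorm x <= 1 -> dual_re f x <= rnorm f.
Proof.
move=> x1; apply: le_trans (dual_re_le f x) _.
by rewrite -[leRHS]mulr1 ler_wpM2l ?rnorm_ge0.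
Qed.

Lemma dual_re_dual_ball f x : rnorm f <= 1 -> dual_re f x <= rnorm x.
Proof.
move=> f1; apply: le_trans (dual_re_le f x) _.
by rewrite -[leRHS]mul1r ler_wpM2r ?rnorm_ge0.
Qed.

Lemma dual_re_phase f x : exists2 w, unit_scalars R k w &
  dual_re f (w *: x) = rnorm ((f : 'L(X, K^o)) x).
Proof.
have [w w1 wf] := scalar_phase ((f : 'L(X, K^o)) x); exists w => //.
by rewrite /dual_re linearZ /= /rnorm -wf.
Qed.

Lemma dual_re_unit_le f w x : unit_scalars R k w ->
  dual_re f (w *: x) <= rnorm ((f : 'L(X, K^o)) x).
Proof.
move=> w1; apply: le_trans (ler_real_part _) _.
by rewrite linearZ rnormZu.
Qed.

Lemma dual_norm_le f (M : R) :
  (forall x, rnorm x <= 1 -> dual_re f x <= M) -> rnorm f <= M.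
Proof.
move=> fM; rewrite rnorm_opnorm; apply: opnorm_le => x x1.
by have [w w1 <-] := dual_re_phase f x; apply: fM; rewrite rnormZu.
Qed.

Lemma dual_norm_adherent f (e : R) : 0 < e ->
  exists2 x, rnorm x <= 1 & rnorm f - e < dual_re f x.
Proof.
move=> e0; apply: contrapT => h.
have : rnorm f <= rnorm f - e.
  apply: dual_norm_le => x x1; rewrite leNgt; apply/negP => fx.
  by apply: h; exists x.
lra.
Qed.

Lemma dual_of_real_linear (F : X -> R) (M : R) : 0 <= M -> real_linear F ->
    (forall x, F x <= M * rnorm x) ->
  exists2 f : dual X, rnorm f <= M & forall x, dual_re f x = F x.
Proof.
move=> M0 fF FM; have [f lf fE] := real_part_linear fF.
have fM : f \in @continuous_linear R k X K^o.
  apply: (@linear_bounded_operator _ _ _ _ _ M) => // x.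
  have [w w1 wf] := scalar_phase (f x).
  have f0 : f 0 = 0.
    by have := lf (-1) 0 0; rewrite scaler0 addr0 scaleN1r addNr.
  have fw : f (w *: x) = w * f x by rewrite -[w *: x]addr0 lf f0 addr0.
  rewrite {1}/rnorm -wf -fw fE (le_trans (FM _))// rnormZu//.
exists (Operator fM) => //; apply: dual_norm_le => x x1.
rewrite /dual_re /= fE (le_trans (FM x))//.
by rewrite -[leRHS]mulr1 ler_wpM2l.
Qed.

(** Hahn-Banach for the norm and the one-point set of [x], at level [rnorm x]. *)
Lemma norming_functional x :
  exists2 f, rnorm f <= 1 & dual_re f x = rnorm x.
Proof.
have cx : real_convex [set x].
  move=> t _ _ _ -> ->.
  by rewrite /= -scalerDl -of_realD addrC subrK of_real1 scale1r.
have [|F [lF Fp /(_ x erefl) Fx]] :=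
    @sublinear_separation _ _ _ _ _ (rnorm x) (@sublinear_rnorm _ _ X _ ler01) cx.
  by move=> _ ->; rewrite mul1r.
have [f f1 fE] := dual_of_real_linear ler01 lF Fp; exists f => //.
by apply/eqP; rewrite eq_le dual_re_dual_ball//= fE.
Qed.

End dual_real_part.

Section bidual.
Context (R : realType) (k : scalar_kind) (X Y : normedModType (scalars R k)).
Local Notation J := (canonical_inclusion X).

Lemma rnorm_canonical_inclusion (x : X) : rnorm (J x) = rnorm x.
Proof.
apply/eqP; rewrite eq_le; apply/andP; split.
  by apply: dual_norm_le => f f1; exact: (dual_re_dual_ball x f1).
have [f f1 <-] := norming_functional x.
exact: (@dual_re_ball _ _ _ (J x)).
Qed.

Lemma rnorm_adjoint (G : 'L(X, Y)) : rnorm (adjoint G) = rnorm G.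
Proof.
apply/eqP; rewrite !rnorm_opnorm eq_le; apply/andP; split.
  apply: opnorm_le => f f1; apply: dual_norm_le => x x1.
  apply: le_trans (dual_re_dual_ball _ f1) _.
  exact: opnorm_ub.
apply: opnorm_le => x x1; have [f f1 <-] := norming_functional (G x).
apply: le_trans (opnorm_ub (adjoint G) f1).
exact: (@dual_re_ball _ _ _ (adjoint G f)).
Qed.

End bidual.

(** * Convex hulls and lush operators *)

Section hull.
Context (R : realType) (k : scalar_kind) (X : normedModType (scalars R k)).
Local Notation K := (scalars R k).
Implicit Types (A F : set X).

Lemma real_convexP A : @convex_set K X A <-> real_convex A.
Proof.
split=> [cA t x y t01 Ax Ay|cA x y t /set_mem Ax /set_mem Ay].
  have [t0 t1] : 0 <= of_real k t /\ of_real k t <= 1.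
    by rewrite -(of_real0 R k) -(of_real1 R k) !of_real_le; exact: (andP t01).
  have /set_mem := cA x y (Itv01 t0 t1) (mem_set Ax) (mem_set Ay).
  by rewrite of_realB of_real1.
apply: mem_set; have t0 : 0 <= t%:num :> K by [].
have t1 : t%:num <= 1 :> K by [].
have tE : of_real k (real_part (t%:num : K)) = t%:num.
  by rewrite real_partK// ger0_real.
have := @cA (real_part (t%:num : K)) x y _ Ax Ay.
rewrite of_realB of_real1 tE; apply.
by rewrite -!(of_real_le k) tE of_real0 of_real1 t0 t1.
Qed.

Lemma convex_hull_real_convex F : real_convex (convex_hull F).
Proof.
move=> t x y t01 Fx Fy A [cA FA]; have /real_convexP cA' := cA.
by apply: cA' => //; [exact: Fx|exact: Fy].
Qed.

Lemma sub_convex_hull F : F `<=` convex_hull F.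
Proof. exact: sub_smallest. Qed.

Lemma convex_hull_sub F A : real_convex A -> F `<=` A -> convex_hull F `<=` A.
Proof. by move=> /real_convexP; exact: smallest_sub. Qed.

Lemma convex_hull_mono F A : F `<=` A -> convex_hull F `<=` convex_hull A.
Proof.
move=> FA; apply: convex_hull_sub; first exact: convex_hull_real_convex.
exact: subset_trans FA (@sub_convex_hull A).
Qed.

Lemma real_convex_halfspace (f : X -> R) (c : R) :
  real_linear f -> real_convex [set x | c <= f x].
Proof.
move=> [fD fZ] t x y /andP[t0 t1] /= fx fy; rewrite fD !fZ; nra.
Qed.

Lemma real_convex_ball (c : R) : real_convex [set x : X | rnorm x <= c].
Proof.
move=> t x y /andP[t0 t1] /= fx fy; rewrite (le_trans (ler_rnormD _ _))//.
rewrite !rnormZr !ger0_norm//; last by rewrite subr_ge0.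
nra.
Qed.

Lemma real_convexI A F : real_convex A -> real_convex F ->
  real_convex (A `&` F).
Proof. by move=> cA cF t x y t01 [Ax Fx] [Ay Fy]; split; [apply: cA|apply: cF]. Qed.

Lemma real_convex_subl A x : real_convex A ->
  real_convex [set x - a | a in A].
Proof.
move=> cA t _ _ t01 [a Aa <-] [b Ab <-].
exists (of_real k t *: a + of_real k (1 - t) *: b); first exact: cA.
rewrite !scalerBr addrACA -scalerDl -of_realD (addrC t) subrK of_real1.
by rewrite scale1r opprD.
Qed.

Lemma sub_aconv F w x : unit_scalars R k w -> F x -> aconv F (w *: x).
Proof. by move=> w1 Fx; apply: sub_convex_hull; exists w => //; exists x. Qed.

End hull.

(** * Spear operators and adjoints *)

Section spear_equation.
Context (R : realType) (k : scalar_kind) (X Y : normedModType (scalars R k)).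
Local Notation K := (scalars R k).
Implicit Types G T : 'L(X, Y).

Lemma spear_equationP G T : rnorm G = 1 ->
  spear_equation G T <->
  forall e, 0 < e ->
    exists2 w, unit_scalars R k w & 1 + rnorm T - e < rnorm (G + w *: T).
Proof.
move=> G1; pose S := [set rnorm (G + w *: T) | w in unit_scalars R k].
have ub w : unit_scalars R k w -> rnorm (G + w *: T) <= 1 + rnorm T.
  move=> w1; rewrite (le_trans (ler_rnormD _ _))// G1 lerD2l.
  by rewrite rnormZu.
have hs : has_sup S.
  split; last by exists (1 + rnorm T) => _ [w w1 <-]; exact: ub.
  by exists (rnorm (G + 1 *: T)), 1 => //; rewrite /unit_scalars/= normr1.
split=> [eq e e0|h].
  have [_ [w w1 <-] h] := sup_adherent e0 hs.
  by exists w => //; rewrite -eq.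
apply/eqP; rewrite /spear_equation eq_le; apply/andP; split.
  by apply: ge_sup => [|_ [w w1 <-]]; [exact: hs.1|exact: ub].
apply/ler_addgt0Pr => e /h[w w1 hw].
have : rnorm (G + w *: T) <= sup S.
  by apply: ub_le_sup; [exact: hs.2|exists w].
by move: hw; rewrite -/S; lra.
Qed.

Lemma opnorm_adherent T (e : R) : 0 < e ->
  exists2 x, rnorm x <= 1 & rnorm T - e < rnorm (T x).
Proof.
move=> e0; have [_ [x x1 <-] h] := sup_adherent e0 (opnorm_has_sup T).
by exists x => //; rewrite rnorm_opnorm.
Qed.

Lemma rnorm_opnorm_ub T x : rnorm x <= 1 -> rnorm (T x) <= rnorm T.
Proof. by rewrite rnorm_opnorm; exact: opnorm_ub. Qed.

Lemma spear_alternative_Daugavet G : spear G -> alternative_Daugavet G.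
Proof. by move=> sG T _; exact: sG. Qed.

(** Take [x0] almost norming [T] and [y] the direction of [T x0]. Lushness gives [F] and one
    functional [g] almost 1 at [y] and at all [G x]. As [x0] is close to [aconv F], some rotated
    point of [F] makes [g (T (w *: x))] almost [rnorm T], and [g] adds the two values. *)
Lemma lush_spear G : lush G -> spear G.
Proof.
move=> [G1 lG] T; apply/spear_equationP => // e e0.
have [T0|T0] := eqVneq (rnorm T) 0.
  exists 1; first by rewrite /unit_scalars/= normr1.
  by rewrite (rnorm_eq0 T0) scaler0 addr0 G1 rnorm0; lra.
have {}T0 : 0 < rnorm T by rewrite lt_neqAle eq_sym T0 rnorm_ge0.
(* [d <= M / 2] keeps [T x0] away from 0; the losses below add up to at most
   [(3 + 2 * M) * d <= e]. *)
pose M := rnorm T; pose d := Num.min (e / (3 * (1 + M))) (M / 2).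
have d0 : 0 < d by rewrite lt_min !divr_gt0//; rewrite /M; lra.
have de : d * (3 * (1 + M)) <= e.
  by rewrite -ler_pdivlMr ?ge_min ?lexx// /M; lra.
have dM : d <= M / 2 by rewrite ge_min lexx orbT.
have [x0 x01 Tx0] := opnorm_adherent T d0.
have Tx0p : 0 < rnorm (T x0) by rewrite /M in dM; lra.
pose y := of_real k (rnorm (T x0))^-1 *: T x0.
have yE : T x0 = of_real k (rnorm (T x0)) *: y.
  by rewrite scalerA -of_realM mulfV ?gt_eqF// of_real1 scale1r.
have y1 : unit_sphere Y y.
  rewrite /unit_sphere/= rnormZr ger0_norm ?invr_ge0 ?(ltW Tx0p)//.
  by rewrite mulVf ?gt_eqF.
have [F [F1 FG]] := lG x0 d y x01 d0 y1.
move=> /ereal_inf_lt[_ [v Fv <-]]; rewrite lte_fin => x0v.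
(* Lushness bounds the norm on the whole convex hull of [F], so a single functional serves every [x]
   in [F]. *)
pose A := [set G x + y | x in convex_hull F].
have cA : real_convex A.
  move=> t _ _ t01 [x Fx <-] [x' Fx' <-].
  exists (of_real k t *: x + of_real k (1 - t) *: x').
    exact: convex_hull_real_convex.
  rewrite linearD !linearZ /= !scalerDr addrACA -scalerDl -of_realD.
  by rewrite (addrC t) subrK of_real1 scale1r.
have [|f [lf f1 fA]] :=
    @sublinear_separation _ _ _ _ A (2 - d) (@sublinear_rnorm _ _ Y _ ler01) cA.
  by move=> _ [x /FG[_ h] <-]; rewrite mul1r ltW.
have [g g1 gE] := dual_of_real_linear ler01 lf f1.
have gF x : F x -> 1 - d <= dual_re g (G x) /\ 1 - d <= dual_re g y.
  move=> Fx; have hFx := sub_convex_hull Fx.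
  have := fA _ (ex_intro2 _ _ x hFx erefl); rewrite -gE dual_reDr.
  have := dual_re_dual_ball (G x) g1; have := dual_re_dual_ball y g1.
  have := rnorm_opnorm_ub G (F1 _ Fx).
  rewrite G1 y1; lra.
have Fne : F !=set0.
  apply: contrapT => F0; have : aconv F `<=` set0.
    apply: convex_hull_sub => [? ? ? ? []|z [w _ [x Fx _]]].
    by apply: F0; exists x.
  by move/(_ _ Fv).
have gy : 1 - d <= dual_re g y by have [x Fx] := Fne; exact: (gF x Fx).2.
have gTv : rnorm (T x0) * (1 - d) - M * d <= dual_re g (T v).
  have -> : dual_re g (T v) = dual_re g (T x0) - dual_re g (T (x0 - v)).
    by rewrite -dual_reBr -linearB subKr.
  have -> : dual_re g (T x0) = rnorm (T x0) * dual_re g y.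
    by rewrite {1}yE dual_reZr.
  have := dual_re_dual_ball (T (x0 - v)) g1.
  have := rnorm_operator T (x0 - v); rewrite -rnorm_opnorm -/M.
  have : M * rnorm (x0 - v) <= M * d by rewrite ler_wpM2l ?rnorm_ge0// ltW.
  have : rnorm (T x0) * (1 - d) <= rnorm (T x0) * dual_re g y.
    by rewrite ler_wpM2l// ltW.
  lra.
(* A half-space containing all generators [w *: x] of [aconv F] would contain [v]. *)
have [x [w [w1 Fx hx]]] : exists x w, [/\ unit_scalars R k w, F x &
    rnorm (T x0) * (1 - d) - M * d - d < dual_re g (T (w *: x))].
  apply: contrapT => h.
  have : aconv F `<=` [set x | - (rnorm (T x0) * (1 - d) - M * d - d) <=
      dual_re g (- T x)].
    apply: convex_hull_sub.
      apply: real_convex_halfspace; split=> [x z|r x].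
        by rewrite linearD opprD dual_reDr.
      by rewrite linearZ /= -scalerN dual_reZr.
    move=> _ [w w1 [x Fx <-]] /=; rewrite dual_reNr lerN2 leNgt.
    by apply/negP => hx; apply: h; exists x, w.
  by move=> /(_ _ Fv) /=; rewrite dual_reNr; lra.
exists w => //; have := rnorm_opnorm_ub (G + w *: T) (F1 _ Fx).
have := dual_re_dual_ball (G x + w *: T x) g1.
rewrite [(G + w *: T) x](_ : _ = G x + w *: T x)// dual_reDr -linearZ.
have := (gF _ Fx).1; move: hx Tx0; rewrite -/M.
move=> /= h1 h2 h3 h4 h5.
have h6 : rnorm (T x0) * d <= M * d.
  by rewrite ler_wpM2r ?(ltW d0)// rnorm_opnorm_ub.
have h7 : 0 <= M * d by rewrite mulr_ge0// ltW.
lra.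
Qed.

Lemma adjointD G T : adjoint (G + T) = adjoint G + adjoint T.
Proof. by apply/operatorP => f; apply/operatorP => x; exact: linearD. Qed.

Lemma adjointZ w T : adjoint (w *: T) = w *: adjoint T.
Proof.
apply/operatorP => f; apply/operatorP => x.
by rewrite adjointE [(w *: T) x](_ : _ = w *: T x)// linearZ.
Qed.

Lemma spear_equation_adjoint G T :
  spear_equation (adjoint G) (adjoint T) -> spear_equation G T.
Proof.
rewrite /spear_equation rnorm_adjoint => <-; congr sup.
by apply: eq_imagel => w _; rewrite -adjointZ -adjointD rnorm_adjoint.
Qed.

(** With [g y = 1] one has [T x = g (T x) *: y], so the adjoint sends [f] to [f y] times
    [adjoint T g]. *)
Lemma rank_one_adjoint T : rank_one T -> rank_one (adjoint T).
Proof.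
move=> [y y0 rT]; have [h h1 hy] := norming_functional y.
pose b := (h : 'L(Y, K^o)) y.
have b0 : b != 0.
  apply: contra_neq y0 => b0; apply: rnorm_eq0.
  by rewrite -hy /dual_re -/b b0 /real_part; case: (k).
pose g : dual Y := b^-1 *: h.
have gy : (g : 'L(Y, K^o)) y = 1 by exact: (mulVf b0).
have TE x : T x = (g : 'L(Y, K^o)) (T x) *: y.
  have [a _ <-] : range (fun a : K => a *: y) (T x) by rewrite -rT; exists x.
  by rewrite dual_scale gy mulr1.
have TsE f : adjoint T f = (f : 'L(Y, K^o)) y *: adjoint T g.
  apply/operatorP => x.
  rewrite [RHS](_ : _ = (f : 'L(Y, K^o)) y * (g : 'L(Y, K^o)) (T x))//.
  by rewrite adjointE TE dual_scale mulrC -TE.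
exists (adjoint T g).
  apply/eqP => Tg0.
  have [x _ Tx] : range T y by rewrite rT; exists 1 => //; exact: scale1r.
  have := adjointE T g x; rewrite Tg0 Tx gy => /esym/eqP.
  by rewrite oner_eq0.
apply/seteqP; split=> [_ [f _ <-]|_ [a _ <-]].
  by exists ((f : 'L(Y, K^o)) y); rewrite // -TsE.
exists (a *: g) => //; rewrite (TsE (a *: g)).
by rewrite [X in X *: _](_ : _ = a * (g : 'L(Y, K^o)) y)// gy mulr1.
Qed.

Lemma alternative_Daugavet_adjoint G :
  alternative_Daugavet (adjoint G) -> alternative_Daugavet G.
Proof.
by move=> aG T /rank_one_adjoint/aG; exact: spear_equation_adjoint.
Qed.

End spear_equation.

Lemma sublinear_sup (R : realType) (k : scalar_kind) (V : lmodType (scalars R k))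
    (I : Type) (B : set I) (f : I -> V -> R) :
    B !=set0 -> (forall i, B i -> real_linear (f i)) ->
    (forall v, has_ubound [set f i v | i in B]) ->
  sublinear (fun v => sup [set f i v | i in B]).
Proof.
move=> [i0 Bi0] lf ubf.
have le v i : B i -> f i v <= sup [set f i v | i in B].
  by move=> Bi; apply: ub_le_sup => //; exists i.
have ge v c : (forall i, B i -> f i v <= c) -> sup [set f i v | i in B] <= c.
  by move=> fc; apply: ge_sup => [|_ [i Bi <-]]; [exists (f i0 v), i0|exact: fc].
split=> [x y|r x r0].
  apply: ge => i Bi; rewrite (lf i Bi).1; apply: lerD; exact: le.
apply/eqP; rewrite eq_le; apply/andP; split.
  by apply: ge => i Bi; rewrite (lf i Bi).2 ler_wpM2l// le.
move: r0; rewrite [0 <= r]le_eqVlt => /orP[/eqP<-|r0].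
  rewrite mul0r; apply: le_trans (le _ _ Bi0).
  by rewrite (lf _ Bi0).2 mul0r.
rewrite -ler_pdivlMl//; apply: ge => i Bi.
by rewrite ler_pdivlMl// -(lf i Bi).2 le.
Qed.

(** * M-embedded spaces *)

Section M_embedded.
Context (R : realType) (k : scalar_kind) (Y : normedModType (scalars R k)).
Local Notation J := (canonical_inclusion Y).

(* [J (adjoint J f)] lies in the complement [W] of the annihilator of [Y]
   because restricting to [Y] does not decrease its norm; hence
   [|f| = |f - J (adjoint J f)| + |J (adjoint J f)|]. *)
Lemma M_embedded_extension (f : dual (dual (dual Y))) : M_embedded Y ->
  rnorm f <= 1 -> 1 <= rnorm (adjoint J f) ->
  f = canonical_inclusion (dual Y) (adjoint J f).
Proof.
move=> [_ [W [_ [dec _ nrm]]]] f1; set g := adjoint J f => g1.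
have [a [w [Aa Ww gaw]]] := dec (canonical_inclusion (dual Y) g).
have gw : rnorm g <= rnorm w.
  apply: dual_norm_le => y y1.
  have -> : dual_re g y = dual_re (canonical_inclusion (dual Y) g) (J y) by [].
  rewrite gaw dual_reDl [X in X + _](_ : _ = 0) ?add0r; last first.
    by rewrite /dual_re Aa ?/real_part//; case: (k).
  by apply: dual_re_ball; rewrite rnorm_canonical_inclusion.
have a0 : a = 0.
  have := nrm _ _ Aa Ww; rewrite -gaw rnorm_canonical_inclusion => h.
  by apply: rnorm_eq0; apply/eqP; rewrite eq_le rnorm_ge0 andbT; lra.
move: gaw; rewrite a0 add0r => gaw.
have Afg : annihilator (range J) (f - canonical_inclusion (dual Y) g).
  move=> _ [y _ <-].
  by rewrite [LHS](_ : _ = adjoint J f y - g y)// subrr.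
have := nrm _ _ Afg Ww; rewrite -gaw subrK rnorm_canonical_inclusion => h.
apply/eqP; rewrite -subr_eq0; apply/eqP; apply: rnorm_eq0.
by apply/eqP; rewrite eq_le rnorm_ge0 andbT; lra.
Qed.

(* If no such [c] exists, some [F] in [Y**] separates [h] from [C] with respect
   to the norm on [S].  Extend [h] from [S] to [f] in [Y***] dominated by the
   support function of [C]; [f] comes from [Y*] by uniqueness of extensions and
   agrees with [h] at [F], whereas [f F <= sup_C F < F h]. *)
Lemma M_embedded_norming_dense (S : set Y) (C : set (dual Y)) (h : dual Y)
    (d : R) :
  M_embedded Y ->
  S 0 -> (forall x y, S x -> S y -> S (x + y)) ->
  (forall r x, S x -> S (of_real k r *: x)) ->
  real_convex C -> (forall c, C c -> rnorm c <= 1) ->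
  (forall y e, S y -> 0 < e -> exists2 c, C c & rnorm y - e <= dual_re c y) ->
  rnorm h <= 1 ->
  (forall e, 0 < e -> exists y, [/\ S y, rnorm y <= 1 & 1 - e <= dual_re h y]) ->
  0 < d ->
  exists2 c, C c & forall y, S y -> rnorm y <= 1 -> dual_re (h - c) y <= d.
Proof.
move=> MY S0 SD SZ cC C1 CS h1 hS d0; apply: contrapT => nC.
have {}nC c : C c -> exists y, [/\ S y, rnorm y <= 1 & d < dual_re (h - c) y].
  move=> Cc; apply: contrapT => ny; apply: nC; exists c => // y Sy y1.
  by rewrite leNgt; apply/negP => hy; apply: ny; exists y.
pose B := [set y | S y /\ rnorm y <= 1].
have B0 : B 0 by split; rewrite ?rnorm0.
have pub (v : dual Y) : has_ubound [set dual_re v y | y in B].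
  by exists (rnorm v) => _ [y [_ y1] <-]; exact: dual_re_ball.
pose p (v : dual Y) := sup [set dual_re v y | y in B].
have sp : sublinear p.
  apply: (sublinear_sup (f := fun y (v : dual Y) => dual_re v y)) => //.
    by exists 0.
  by move=> y _; split=> *; rewrite ?dual_reDl ?dual_reZl.
have [c0 Cc0 _] := CS _ _ S0 ltr01.
have cA := real_convex_subl (x := h) cC.
have [|F [lF Fp FC]] := @sublinear_separation _ _ _ _ _ d sp cA.
  move=> _ [c Cc <-]; have [y [Sy y1 hy]] := nC _ Cc.
  by rewrite (le_trans (ltW hy))//; apply: ub_le_sup => //; exists y.
have Fn v : F v <= 1 * rnorm v.
  rewrite mul1r (le_trans (Fp v))//; apply: ge_sup.
    by exists (dual_re v 0), 0.
  by move=> _ [y [_ y1] <-]; exact: dual_re_ball.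
(* As an element [G] of the bidual, [F] can be evaluated by [f]; once [f] is known to come from [g],
   this reads [P G = F g]. *)
have [G _ GE] := dual_of_real_linear ler01 lF Fn.
have qub (v : dual (dual Y)) : has_ubound [set dual_re v c | c in C].
  by exists (rnorm v) => _ [c Cc <-]; exact/dual_re_ball/C1.
pose q (v : dual (dual Y)) := sup [set dual_re v c | c in C].
have sq : sublinear q.
  apply: (sublinear_sup (f := fun c (v : dual (dual Y)) => dual_re v c)) => //.
    by exists c0.
  by move=> y _; split=> *; rewrite ?dual_reDl ?dual_reZl.
(* The constraints [h y <= P (J y)] at [y] and [- y] force equality on [S]. *)
pose D := [set (J y, dual_re h y) | y in S].
have cD : convex_cone D.
  split.
  - by exists 0; rewrite // linear0 real_linear0//; exact: dual_re_linear.
  - move=> _ _ [x Sx <-] [y Sy <-]; exists (x + y); first exact: SD.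
    by rewrite linearD dual_reDr.
  - move=> r _ _ [x Sx <-]; exists (of_real k r *: x); first exact: SZ.
    by rewrite linearZ dual_reZr.
have [|P [lP Pq PD]] := mazur_orlicz sq cD.
  move=> _ [y Sy <-] /=; apply/ler_addgt0Pr => e e0.
  have [c Cc hc] := CS _ _ Sy e0.
  have : dual_re c y <= q (J y) by apply: ub_le_sup => //; exists c.
  by have := dual_re_dual_ball y h1; lra.
have Pn v : P v <= 1 * rnorm v.
  rewrite mul1r (le_trans (Pq v))//; apply: ge_sup.
    by exists (dual_re v c0), c0.
  by move=> _ [c Cc <-]; exact/dual_re_ball/C1.
have [f f1 fE] := dual_of_real_linear ler01 lP Pn.
pose g := adjoint J f.
have gP y : dual_re g y = P (J y) by rewrite -fE.
have gh y : S y -> dual_re g y = dual_re h y.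
  move=> Sy; apply/eqP; rewrite eq_le gP; apply/andP; split; last first.
    by apply: (PD (J y, dual_re h y)); exists y.
  rewrite -lerN2 -(real_linearN _ lP) -linearN -dual_reNr.
  apply: (PD (J (- y), dual_re h (- y))); exists (- y) => //.
  by have := SZ (-1) _ Sy; rewrite of_realN of_real1 scaleN1r.
have g1 : 1 <= rnorm g.
  apply/ler_addgt0Pr => e /hS[y [Sy y1]]; rewrite -gh//.
  by have := dual_re_ball g y1; lra.
have fg := M_embedded_extension MY f1 g1.
have PG : P G = F g by rewrite -fE fg -GE.
have : F (h - g) <= 0.
  rewrite (le_trans (Fp _))//; apply: ge_sup; first by exists (dual_re (h - g) 0), 0.
  by move=> _ [y [Sy _] <-]; rewrite dual_reBl gh// subrr.
have : P G <= F h - d.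
  rewrite (le_trans (Pq _))//; apply: ge_sup.
    by exists (dual_re G c0), c0.
  move=> _ [c Cc <-]; rewrite GE.
  have := FC (h - c) (ex_intro2 _ _ c Cc erefl).
  by rewrite real_linearB//; lra.
by rewrite PG real_linearB//; lra.
Qed.

End M_embedded.

(** * Small slices of the dual ball *)

Section nested_balls.
Context (R : realType) (k : scalar_kind) (Y : completeNormedModType (scalars R k)).
Variables (u : nat -> Y) (s : nat -> R).
Hypothesis s0 : forall n, 0 < s n.
Hypothesis s_half : forall n, s n.+1 <= s n / 2.
Hypothesis us : forall n, rnorm (u n.+1 - u n) + s n.+1 <= s n.

(** Halving gives [s n * (n + 1) <= s 0], enough for the Archimedean property. *)
Lemma nested_radius_small (e : R) : 0 < e -> exists n, s n < e.
Proof.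
move=> e0; have sn n : s n * n.+1%:R <= s 0%N.
  elim: n => [|n IH]; first by rewrite mulr1.
  apply: le_trans IH; apply: le_trans (ler_wpM2r _ (s_half n)) _ => //.
  rewrite -mulrA ler_wpM2l ?(ltW (s0 n))//.
  by rewrite -(natr1 n.+1) -(natr1 n); have := ler0n R n; lra.
have h : 0 <= s 0%N / e by rewrite divr_ge0 ?ltW.
exists (Num.bound (s 0%N / e)); rewrite ltNge; apply/negP => es.
have := archi_boundP h; rewrite ltr_pdivrMr// ltNge => /negP; apply.
apply: le_trans (sn _); rewrite mulrC -natr1.
have := ler0n R (Num.bound (s 0%N / e)); nra.
Qed.

Lemma nested_balls_le n m : rnorm (u (n + m)%N - u n) + s (n + m)%N <= s n.
Proof.
elim: m => [|m IH]; first by rewrite addn0 subrr rnorm0 add0r.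
rewrite addnS; have := us (n + m).
have := ler_rnormD (u (n + m).+1 - u (n + m)%N) (u (n + m)%N - u n).
by rewrite subrKA; lra.
Qed.

Lemma nested_balls_limit : exists y, forall n, rnorm (y - u n) <= s n.
Proof.
have dist n m : (n <= m)%N -> rnorm (u m - u n) <= s n.
  move=> /subnKC <-; have := nested_balls_le n (m - n).
  by have := s0 (n + (m - n)); lra.
have /cauchy_cvg/cvg_ex[y uy] : cauchy (u @ \oo).
  apply: cauchy_exP => eps eps0.
  have epsE : of_real k (real_part eps) = eps.
    by rewrite real_partK// gtr0_real.
  have e0 : 0 < real_part eps.
    by rewrite -(of_real_lt k) epsE of_real0.
  have [n sn] := nested_radius_small e0; exists (u n); exists n => // m /= nm.
  rewrite -ball_normE /= -rnormE -epsE of_real_lt rnormBC.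
  exact: le_lt_trans (dist _ _ nm) sn.
exists y => n; apply/ler_addgt0Pr => e e0.
have e0' : 0 < of_real k e by rewrite -(of_real0 R k) of_real_lt.
have /cvgrPdist_le/(_ _ e0')[m _ hm] := uy.
have := hm (maxn m n) (leq_maxl _ _); have := dist _ _ (leq_maxr m n).
rewrite /= -rnormE of_real_le.
by have := ler_rnormD (y - u (maxn m n)) (u (maxn m n) - u n); rewrite subrKA; lra.
Qed.

End nested_balls.

Section rational_span.
Context (R : realType) (k : scalar_kind) (X : normedModType (scalars R k)).
Variables (T : Type) (v : T -> X).

(** Rational coefficients and finite sequences make the index type countable when [T] is, so that
    the combinations can be enumerated by [unpickle]. *)
Definition rat_comb (s : seq (rat * T)) : X :=
  \sum_(x <- s) of_real k (ratr x.1) *: v x.2.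

(** The norm closed real linear span of the values of [v]. *)
Definition rat_closure : set X :=
  [set x | forall e : R, 0 < e -> exists s, rnorm (x - rat_comb s) <= e].

Lemma rat_closure_cvg x :
  (forall e, 0 < e -> exists2 y, rat_closure y & rnorm (x - y) <= e) ->
  rat_closure x.
Proof.
move=> h e e0; have e20 : 0 < e / 2 by lra.
have [y /(_ _ e20)[s ys] xy] := h _ e20; exists s.
have := ler_rnormD (x - y) (y - rat_comb s).
by rewrite subrKA; lra.
Qed.

Lemma rat_closure_comb s : rat_closure (rat_comb s).
Proof. by move=> e e0; exists s; rewrite subrr rnorm0 ltW. Qed.

Lemma rat_closure_gen t : rat_closure (v t).
Proof.
rewrite [v t](_ : _ = rat_comb [:: (1, t)]); first exact: rat_closure_comb.
by rewrite /rat_comb big_seq1 /= rmorph1 of_real1 scale1r.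
Qed.

Lemma rat_closure0 : rat_closure 0.
Proof. by have := rat_closure_comb [::]; rewrite /rat_comb big_nil. Qed.

Lemma rat_closureD x y : rat_closure x -> rat_closure y -> rat_closure (x + y).
Proof.
move=> hx hy e e0; have e20 : 0 < e / 2 by lra.
have [s xs] := hx _ e20; have [t yt] := hy _ e20; exists (s ++ t).
rewrite /rat_comb big_cat /= opprD addrACA.
by have := ler_rnormD (x - rat_comb s) (y - rat_comb t); rewrite /rat_comb; lra.
Qed.

Lemma rat_closureZ (r : R) x : rat_closure x -> rat_closure (of_real k r *: x).
Proof.
move=> hx e e0.
have r1 : 0 < `|r| + 1 by have := normr_ge0 r; lra.
have [|s xs] := hx (e / 2 / (`|r| + 1)); first by rewrite !divr_gt0.
pose M := rnorm (rat_comb s) + 1.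
have M0 : 0 < M by have := rnorm_ge0 (rat_comb s); rewrite /M; lra.
have [q] : exists q : rat, ratr q \in `]r, r + e / 2 / M[.
  by apply: rat_in_itvoo; rewrite ltrDl !divr_gt0.
rewrite in_itv /= => /andP[rq qr].
exists [seq (q * x.1, x.2) | x <- s].
have -> : rat_comb [seq (q * x.1, x.2) | x <- s] =
    of_real k (ratr q) *: rat_comb s.
  rewrite /rat_comb big_map scaler_sumr; apply: eq_bigr => i _ /=.
  by rewrite rmorphM /= of_realM scalerA.
rewrite (_ : _ - _ = of_real k r *: (x - rat_comb s) +
    of_real k (r - ratr q) *: rat_comb s); last first.
  by rewrite scalerBr of_realB scalerBl addrA subrK.
apply: le_trans (ler_rnormD _ _) _; rewrite !rnormZr.
have : `|r| * rnorm (x - rat_comb s) <= e / 2.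
  apply: le_trans (ler_wpM2l (normr_ge0 _) xs) _.
  by rewrite mulrCA -[leRHS]mulr1 ler_wpM2l ?ler_pdivrMr//; lra.
have : `|r - ratr q| * rnorm (rat_comb s) <= e / 2.
  have -> : `|r - ratr q| = ratr q - r by rewrite distrC gtr0_norm// subr_gt0.
  have {}qr : (ratr q - r) * M <= e / 2 by rewrite -ler_pdivlMr//; lra.
  apply: le_trans qr; rewrite ler_wpM2l ?subr_ge0 ?(ltW rq)// /M; lra.
lra.
Qed.

Lemma rat_closure_convex : real_convex rat_closure.
Proof. by move=> t x y _ hx hy; apply: rat_closureD; exact: rat_closureZ. Qed.

End rational_span.

Section small_slices.
Context (R : realType) (k : scalar_kind) (Y : completeNormedModType (scalars R k)).

(** A diameter bound for a weak* slice of the dual ball; the depth is measured from [rnorm y], so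
    [y] is not normalised. *)
Definition small_slice (y : Y) (d e : R) := forall f g : dual Y,
  rnorm f <= 1 -> rnorm g <= 1 ->
  rnorm y - d <= dual_re f y -> rnorm y - d <= dual_re g y -> rnorm (f - g) <= e.

(* A quadruple [(z, t, s', a)] splitting the ball of center [y] and radius [s]:
   the norming functionals of points of the two balls of radius [s'] centered
   at [y + t z] and [y - t z] are separated by their values at [z]. *)
Definition splits (e : R) (y : Y) (s : R) (z : Y) (t s' a : R) :=
  [/\ 0 < t /\ 0 < s', s' <= s / 2, t + s' <= s / 2, rnorm z <= 1 &
   forall (h : dual Y) w, rnorm h <= 1 -> dual_re h w = rnorm w ->
    (rnorm (w - (y + of_real k t *: z)) <= s' -> a + e / 4 <= dual_re h z) /\
    (rnorm (w - (y - of_real k t *: z)) <= s' -> dual_re h z <= a - e / 4)].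

(** A slice of large diameter contains [f] and [g] far apart at some [z]. By convexity of the norm,
    functionals norming points near [y + t z] are almost at least [f] at [z], and those norming
    points near [y - t z] almost at most [g]. *)
Lemma no_small_slice_splits (e : R) (y : Y) (s : R) : 0 < e -> 0 < s ->
  (forall d, 0 < d -> ~ small_slice y d e) ->
  exists z t s' a, splits e y s z t s' a.
Proof.
move=> e0 s0 nslice.
(* [d] is both the slice depth and the radius of the new balls; the comparison [key] loses
   [3 * d / t <= 3 * e / 32]. *)
pose t := s / 4; pose d := Num.min (s / 4) (t * e / 32).
have t0 : 0 < t by rewrite /t; lra.
have te0 : 0 < t * e by rewrite mulr_gt0.
have d0 : 0 < d by rewrite lt_min; apply/andP; split; lra.
have ds : d <= s / 4 by rewrite ge_min lexx.
have dt : d <= t * e / 32 by rewrite ge_min lexx orbT.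
have [f [g [z [f1 g1 fy gy [z1 fgz]]]]] : exists f g z, [/\ rnorm f <= 1,
    rnorm g <= 1, rnorm y - d <= dual_re f y, rnorm y - d <= dual_re g y &
    rnorm z <= 1 /\ e < dual_re (f - g) z].
  apply: contrapT => h; apply: (nslice d d0) => f g f1 g1 fy gy.
  apply: dual_norm_le => z z1; rewrite leNgt; apply/negP => fgz.
  by apply: h; exists f, g, z.
(* The midpoint is more than [e / 2] from both values, and [e / 2 - 3 * e / 32 >= e / 4]. *)
exists z, t, d, ((dual_re f z + dual_re g z) / 2).
split=> //; [by lra|by rewrite /t; lra|].
rewrite dual_reBl in fgz.
(* the increment of the norm from [y] to [w] is at least that of [f'] and at
   most that of [h] *)
have key (f' h : dual Y) (z' w : Y) : rnorm f' <= 1 -> rnorm h <= 1 ->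
    rnorm y - d <= dual_re f' y -> dual_re h w = rnorm w ->
    rnorm (w - (y + of_real k t *: z')) <= d ->
    dual_re f' z' - 3 * e / 32 <= dual_re h z'.
  move=> f'1 h1 f'y hw wd; set y' := y + of_real k t *: z' in wd.
  have hy' : rnorm y' - 2 * d <= dual_re h y'.
    have := dual_re_dual_ball (w - y') h1; rewrite dual_reBr hw.
    have := ler_rnormB y' w; rewrite rnormBC; lra.
  have f'y' := dual_re_dual_ball y' f'1.
  have hy := dual_re_dual_ball y h1.
  move: hy' f'y'; rewrite !dual_reDr !dual_reZr => hy' f'y'.
  rewrite -(ler_pM2l t0); lra.
move=> h w h1 hw; split=> wd.
  have := key f h z w f1 h1 fy hw wd; lra.
have := key g h (- z) w g1 h1 gy hw; rewrite scalerN => /(_ wd).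
by rewrite !dual_reNr; lra.
Qed.

End small_slices.

(* Otherwise every ball splits, giving a binary tree of balls.  Let [S] be the
   closed span of the centers; functionals on [S] are approximated by a countable
   set, and a branch avoiding the [n]-th element of that set at level [n] leads
   to a point whose norming functional is not approximated. *)
Lemma M_embedded_small_slice (R : realType) (k : scalar_kind)
    (Y : completeNormedModType (scalars R k)) (y0 : Y) (r e : R) :
  M_embedded Y -> y0 != 0 -> 0 < r -> 0 < e ->
  exists y d, [/\ rnorm (y - y0) <= r, 0 < d & small_slice y d e].
Proof.
move=> MY y00 r0 e0.
have ny0 : 0 < rnorm y0.
  by rewrite lt_neqAle rnorm_ge0 andbT eq_sym; apply: contra_neq y00 => /rnorm_eq0.
(* Staying within [rnorm y0 / 2] of [y0] keeps the limit of a branch nonzero. *)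
pose r' := Num.min r (rnorm y0 / 2).
have r'0 : 0 < r' by rewrite lt_min r0; lra.
have r'r : r' <= r by rewrite ge_min lexx.
have r'y : r' <= rnorm y0 / 2 by rewrite ge_min lexx orbT.
apply: contrapT => nS.
have nslice y d : rnorm (y - y0) <= r' -> 0 < d -> ~ small_slice y d e.
  by move=> yy0 d0 sl; apply: nS; exists y, d; split=> //; lra.
(* Off the admissible balls the value is a dummy, so that [choice] yields a total function. *)
have step (p : Y * R) : exists q : Y * R * R * R,
    rnorm (p.1 - y0) <= r' -> 0 < p.2 ->
    splits e p.1 p.2 q.1.1.1 q.1.1.2 q.1.2 q.2.
  have [py0|npy0] := pselect (rnorm (p.1 - y0) <= r'); last by exists (0, 0, 0, 0).
  have [p20|np20] := pselect (0 < p.2); last by exists (0, 0, 0, 0).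
  have [z [t [s [a h]]]] := no_small_slice_splits e0 p20 (fun d => @nslice _ d py0).
  by exists (z, t, s, a).
have [st stP] := choice step.
pose zof p := (st p).1.1.1; pose tof p := (st p).1.1.2.
pose rof p := (st p).1.2; pose aof p := (st p).2.
pose child (b : bool) (p : Y * R) : Y * R :=
  (if b then p.1 + of_real k (tof p) *: zof p
   else p.1 - of_real k (tof p) *: zof p, rof p).
(* A node is addressed by the word of its turns, the latest turn at the head. *)
pose node := foldr child (y0, r').
pose ctr l := (node l).1; pose rad l := (node l).2.
have childP b p : 0 < p.2 -> rnorm (p.1 - y0) <= r' ->
    [/\ 0 < (child b p).2, (child b p).2 <= p.2 / 2 &
        rnorm ((child b p).1 - p.1) + (child b p).2 <= p.2 / 2].
  move=> p20 py0; have [[t0 s0] s2 ts z1 _] := stP p py0 p20.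
  split=> //; apply: le_trans ts; rewrite lerD2r.
  have -> : rnorm ((child b p).1 - p.1) = tof p * rnorm (zof p).
    rewrite -[tof p](gtr0_norm t0) -rnormZr /child; case: b => /=.
      by rewrite addrAC subrr add0r.
    by rewrite addrAC subrr add0r rnormN.
  by rewrite -[leRHS]mulr1 ler_wpM2l// ltW.
have inv l : 0 < rad l /\ rnorm (ctr l - y0) + rad l <= r'.
  elim: l => [|b l [IH1 IH2]]; first by rewrite /ctr subrr rnorm0 add0r.
  have [|h1 h2 h3] := childP b (node l) IH1.
    by move: IH1 IH2; rewrite /ctr /rad; lra.
  split=> //; have := ler_rnormD (ctr (b :: l) - ctr l) (ctr l - y0).
  rewrite subrKA; move: h1 h2 h3 IH1 IH2.
  rewrite -/(node (b :: l)) -/(ctr (b :: l)) -/(rad (b :: l)) /rad /ctr /=; lra.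
have ctrB l : rnorm (ctr l - y0) <= r' by have := inv l; lra.
have spl l := stP (node l) (ctrB l) (inv l).1.
pose S := rat_closure ctr.
have Sz l : S (zof (node l)).
  have [[t0 _] _ _ _ _] := spl l.
  rewrite (_ : zof _ = of_real k (tof (node l))^-1 *: (ctr (true :: l) +
      of_real k (-1) *: ctr l)).
    apply/rat_closureZ/rat_closureD; first exact: rat_closure_gen.
    exact/rat_closureZ/rat_closure_gen.
  rewrite of_realN of_real1 scaleN1r /ctr /= addrAC subrr add0r.
  by rewrite scalerA -of_realM mulVf ?gt_eqF// of_real1 scale1r.
(* Functionals norming the countably many rational combinations of centers norm all of [S] by
   density. *)
have /choice[a aP] : forall s, exists f : dual Y, rnorm f <= 1 /\
    dual_re f (rat_comb ctr s) = rnorm (rat_comb ctr s).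
  by move=> s; have [f ? ?] := norming_functional (rat_comb ctr s); exists f.
pose C := convex_hull (range a).
have C1 c : C c -> rnorm c <= 1.
  apply: (convex_hull_sub (A := [set c : dual Y | rnorm c <= 1])).
    exact: real_convex_ball.
  by move=> _ [s _ <-]; exact: (aP s).1.
have CS y eps : S y -> 0 < eps ->
    exists2 c, C c & rnorm y - eps <= dual_re c y.
  move=> Sy eps0; have [|s ys] := Sy (eps / 2); first by lra.
  exists (a s); first by apply: sub_convex_hull; exists s.
  have := dual_re_dual_ball (rat_comb ctr s - y) (aP s).1.
  rewrite dual_reBr (aP s).2 rnormBC.
  by have := ler_rnormB y (rat_comb ctr s); lra.
have Ca c : C c -> rat_closure a c.
  apply: convex_hull_sub; first exact: rat_closure_convex.
  by move=> _ [s _ <-]; exact: rat_closure_gen.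
(* the branch steers away from the [n]-th element of the rational span of [a]
   at level [n] *)
pose code n : dual Y := if unpickle n is Some u then rat_comb a u else 0.
pose dir n l : bool := dual_re (code n) (zof (node l)) <= aof (node l).
pose fix branch n := if n is m.+1 then dir m (branch m) :: branch m else [::].
have [n|n|n|y yu] := @nested_balls_limit _ _ Y (ctr \o branch) (rad \o branch).
- exact: (inv _).1.
- have [|_ h _] := childP (dir n (branch n)) (node (branch n)) (inv _).1 => //.
  exact: ctrB.
- have [|_ _ h] := childP (dir n (branch n)) (node (branch n)) (inv _).1.
    exact: ctrB.
  apply: le_trans h _; have := (inv (branch n)).1.
  by rewrite /rad /=; lra.
have Sy : S y.
  apply: rat_closure_cvg => eps eps0.
  have [n|n|n sn] := @nested_radius_small _ (rad \o branch) _ _ _ eps0.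
  - exact: (inv _).1.
  - have [|_ h _] := childP (dir n (branch n)) (node (branch n)) (inv _).1 => //.
    exact: ctrB.
  exists (ctr (branch n)); first exact: rat_closure_gen.
  exact: le_trans (yu n) (ltW sn).
have y_neq0 : 0 < rnorm y.
  by have := yu 0%N; have := ler_rnormB y0 y; rewrite rnormBC /ctr /rad /=; lra.
have [h h1 hy] := norming_functional y.
have hS eps : 0 < eps ->
    exists x, [/\ S x, rnorm x <= 1 & 1 - eps <= dual_re h x].
  move=> eps0; exists (of_real k (rnorm y)^-1 *: y); split.
  - exact: rat_closureZ.
  - by rewrite rnormZr gtr0_norm ?invr_gt0// mulVf ?gt_eqF.
  - by rewrite dual_reZr hy mulVf ?gt_eqF//; lra.
have e16 : 0 < e / 16 by lra.
have [||||c Cc hc] := @M_embedded_norming_dense _ _ _ S C h (e / 16)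
  MY _ _ _ _ C1 CS h1 hS e16.
- exact: rat_closure0.
- exact: rat_closureD.
- exact: rat_closureZ.
- exact: convex_hull_real_convex.
have [u cu] := Ca _ Cc _ e16.
(* At [z] the functional [h] is within [e / 16] of [c], and [c] within [e / 16] of the combination
   coded by [u]. But at level [n] the branch turned so that [h] is [e / 4] beyond the threshold on
   the side opposite to that combination. *)
pose n := pickle u; pose l := branch n; pose z := zof (node l).
have codeE : code n = rat_comb a u by rewrite /code pickleK.
have [[t0 s0] _ _ z1 sep] := spl l.
have hz1 := hc _ (Sz l) z1.
have hz2 : dual_re (h - c) (- z) <= e / 16.
  apply: hc; last by rewrite rnormN.
  by have := rat_closureZ (-1) (Sz l); rewrite of_realN of_real1 scaleN1r.
have cz1 := dual_re_ball (c - rat_comb a u) z1.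
have cz2 : dual_re (c - rat_comb a u) (- z) <= rnorm (c - rat_comb a u).
  by apply: dual_re_ball; rewrite rnormN.
have [sep1 sep2] := sep h y h1 hy.
have := yu n.+1; rewrite /= -/l /dir codeE.
move: hz1 hz2 cz1 cz2 sep1 sep2.
rewrite !dual_reNr !dual_reBl -/z -/(aof (node l)) => hz1 hz2 cz1 cz2 sep1 sep2.
have [cza|cza] := leP (dual_re (rat_comb a u) z) (aof (node l)).
  by move=> /sep1; rewrite -/z; lra.
by move=> /sep2; rewrite -/z; lra.
Qed.

(** * Almost spear functionals *)

Section almost_spear.
Context (R : realType) (k : scalar_kind) (X : normedModType (scalars R k)).

(* What [sup_w |u + w t f| >= 1 - e + t |f|] says for large [t]. *)
Definition almost_spear (e : R) (u : dual X) := forall (f : dual X) (d : R),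
  0 < d -> exists x w, [/\ rnorm x <= 1, unit_scalars R k w,
    1 - e <= dual_re u x & rnorm f - d <= dual_re f (w *: x)].

Lemma almost_spearN e u : almost_spear e u -> almost_spear e (- u).
Proof.
move=> su f d /(su f)[x [w [x1 w1 ux fx]]]; exists (- x), (- w).
by rewrite rnormN dual_reNr dual_reNl opprK scaleNr scalerN opprK; split=> //;
  exact: unit_scalarsN.
Qed.

Lemma convex_hullN (F : set X) : (forall x, F x -> F (- x)) ->
  forall x, convex_hull F x -> convex_hull F (- x).
Proof.
move=> FN; apply: (convex_hull_sub (A := [set x | convex_hull F (- x)])).
  move=> t x y t01 /= Fx Fy; rewrite opprD -!scalerN.
  exact: convex_hull_real_convex.
by move=> x /FN; exact: sub_convex_hull.
Qed.

(** A functional separating [x0] from the hull by [d] is almost normed by a rotated point of the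
    slice, a contradiction. *)
Lemma almost_spear_aconv (e : R) (u : dual X) (x0 : X) (d : R) :
  almost_spear e u -> rnorm x0 <= 1 -> 0 < d ->
  exists2 c, aconv [set x | rnorm x <= 1 /\ 1 - e <= dual_re u x] c &
    rnorm (x0 - c) <= d.
Proof.
move=> su x01 d0; set F := [set x | _]; apply: contrapT => nc.
pose A := [set x0 - c | c in aconv F].
have cA : real_convex A.
  by apply: real_convex_subl; exact: convex_hull_real_convex.
have [|f [lf f1 fA]] :=
    @sublinear_separation _ _ _ _ A d (@sublinear_rnorm _ _ X _ ler01) cA.
  move=> _ [c Cc <-]; rewrite mul1r leNgt; apply/negP => h.
  by apply: nc; exists c => //; exact: ltW.
have [g g1 gE] := dual_of_real_linear ler01 lf f1.
have d20 : 0 < d / 2 by lra.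
have [x [w [x1 w1 ux fx]]] := su g _ d20.
have Cwx : aconv F (w *: x) by apply: sub_aconv.
have := fA _ (ex_intro2 _ _ _ Cwx erefl); rewrite -gE dual_reBr.
by have := dual_re_ball g x01; lra.
Qed.

End almost_spear.

Section lush_criterion.
Context (R : realType) (k : scalar_kind) (X Y : normedModType (scalars R k)).

(** The slice where [z (G x)] is large is convex, and on it [z] bounds [rnorm (G x + y)] from below
    by [z (G x) + z y]. *)
Lemma lush_of_functional (G : 'L(X, Y)) : rnorm G = 1 ->
  (forall x0 y (e : R), rnorm x0 <= 1 -> rnorm y = 1 -> 0 < e ->
    exists z : dual Y, [/\ rnorm z <= 1, 1 - e < dual_re z y &
      exists2 c, aconv [set x | rnorm x <= 1 /\ 1 - e <= dual_re z (G x)] c &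
        rnorm (x0 - c) <= e]) ->
  lush G.
Proof.
move=> G1 h; split=> // x0 e y x01 e0 y1; have e30 : 0 < e / 3 by lra.
have [z [z1 zy [c Fc x0c]]] := h x0 y _ x01 y1 e30.
set F := [set x | _] in Fc.
have cF : real_convex F.
  apply: real_convexI; first exact: real_convex_ball.
  apply: (real_convex_halfspace _ (f := fun x => dual_re z (G x))).
  by split=> [x x'|r x]; rewrite ?linearD ?dual_reDr// linearZ dual_reZr.
exists F; split; first by move=> x [].
  apply: (subset_trans (convex_hull_sub cF (@subset_refl _ F))) => x [x1 zx].
  split=> //; have := dual_re_dual_ball (G x + y) z1.
  by rewrite dual_reDr /=; lra.
apply: le_lt_trans (_ : _ <= (rnorm (x0 - c))%:E)%E _.
  by apply: ereal_inf_lbound; exists c.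
by rewrite lte_fin; lra.
Qed.

End lush_criterion.

Section rank_one.
Context (R : realType) (k : scalar_kind) (X Y : normedModType (scalars R k)).
Local Notation K := (scalars R k).
Variables (f : dual X) (y : Y).

Let tensor_fun (x : X) : Y := (f : 'L(X, K^o)) x *: y.

Let tensor_subproof : tensor_fun \in @continuous_linear R k X Y.
Proof.
apply: (@linear_bounded_operator _ _ _ _ _ (rnorm f * rnorm y)).
  by move=> a x x'; rewrite /tensor_fun linearP scalerDl -scalerA.
move=> x; rewrite /tensor_fun rnormZ mulrAC ler_wpM2r ?rnorm_ge0//.
by rewrite rnorm_opnorm; exact: rnorm_operator.
Qed.

Definition tensor : 'L(X, Y) := Operator tensor_subproof.

Lemma rank_one_tensor : 0 < rnorm f -> 0 < rnorm y -> rank_one tensor.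
Proof.
move=> f0 y0; exists y.
  by apply/eqP => yE; rewrite yE rnorm0 ltxx in y0.
have [x _ fx] := dual_norm_adherent f f0; rewrite subrr in fx.
have fx0 : (f : 'L(X, K^o)) x != 0.
  apply: contraTneq fx => fx.
  by rewrite /dual_re fx /real_part; case: (k); rewrite ltxx.
apply/seteqP; split=> [_ [x' _ <-]|_ [a _ <-]].
  by exists ((f : 'L(X, K^o)) x').
exists ((a / (f : 'L(X, K^o)) x) *: x) => //.
by rewrite /= /tensor_fun dual_scale divfK.
Qed.

Lemma rnorm_tensor_ge : 0 < rnorm y -> rnorm f * rnorm y <= rnorm tensor.
Proof.
move=> y0; rewrite -ler_pdivlMr//; apply: dual_norm_le => x x1.
rewrite ler_pdivlMr//; apply: le_trans (rnorm_opnorm_ub tensor x1).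
rewrite rnormZ ler_wpM2r ?rnorm_ge0//.
exact: ler_real_part.
Qed.

End rank_one.

(** * Almost spear points from the alternative Daugavet property *)

Section alternative_Daugavet.
Context (R : realType) (k : scalar_kind).
Context (X : normedModType (scalars R k)) (Y : completeNormedModType (scalars R k)).
Local Notation K := (scalars R k).
Variable G : 'L(X, Y).
Hypotheses (G1 : rnorm G = 1) (aG : alternative_Daugavet G).

Lemma exists_adjoint_neq0 : exists g, 0 < rnorm (adjoint G g).
Proof.
have [x x1 Gx] := opnorm_adherent G ltr01; rewrite G1 subrr in Gx.
have [g g1 gx] := norming_functional (G x); exists g.
apply: lt_le_trans (_ : dual_re g (G x) <= _); first by rewrite gx.
exact: (@dual_re_ball _ _ _ (adjoint G g)).
Qed.

(** Test the property on the rank-one operator [tensor f y]. A functional [g] norming an almost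
    maximal value has [g (G x)] close to 1 and, in modulus, [f x] close to [rnorm f] and [g y] close
    to [rnorm y]. A rotation of [g] then lies in the slice, hence is [e]-close to [z]. *)
Lemma small_slice_almost_spear (y : Y) (d e : R) (z : dual Y) :
  0 < rnorm y -> 0 < d -> 0 < e -> small_slice y d e ->
  rnorm z <= 1 -> rnorm y - d <= dual_re z y ->
  almost_spear (2 * e) (adjoint G z).
Proof.
move=> y0 d0 e0 sl z1 zy.
(* For [f = 0] the tensor is not of rank one; points found for any nonzero functional serve. *)
suff key (f : dual X) (eta : R) : 0 < rnorm f -> 0 < eta ->
    exists x w, [/\ rnorm x <= 1, unit_scalars R k w,
      1 - 2 * e <= dual_re (adjoint G z) x & rnorm f - eta <= dual_re f (w *: x)].
  move=> f eta eta0; have [f0|] := ltP 0 (rnorm f); first exact: key.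
  move=> f0; have {f0} -> : f = 0.
    by apply: rnorm_eq0; apply/eqP; rewrite eq_le f0 rnorm_ge0.
  have [g g0] := exists_adjoint_neq0.
  have [x [w [x1 w1 zx _]]] := key _ _ g0 ltr01.
  exists x, w; split=> //; rewrite rnorm0 dual_re0l; lra.
move=> f0 eta0.
(* The choices of [w] and [x] lose [m] each; the three bounds turn [2 * m] into losses [e] for
   [g (G x)], [eta] for [f x] and [d] for [g y]. *)
pose m := Num.min (e / 2) (Num.min (d * rnorm f / 2) (eta * rnorm y / 2)).
have m0 : 0 < m by rewrite !lt_min; apply/and3P; split; rewrite divr_gt0// mulr_gt0.
have me : m <= e / 2 by rewrite ge_min lexx.
have md : m <= d * rnorm f / 2 by rewrite !ge_min lexx orbT.
have meta : m <= eta * rnorm y / 2 by rewrite !ge_min lexx !orbT.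
have [w w1 hw] := (spear_equationP (tensor f y) G1).1 (aG (rank_one_tensor f0 y0)) _ m0.
have [x x1 hx] := opnorm_adherent (G + w *: tensor f y) m0.
have [g g1 gx] := norming_functional ((G + w *: tensor f y) x).
pose fx := (f : 'L(X, K^o)) x; pose gy := (g : 'L(Y, K^o)) y.
have fx_le : rnorm fx <= rnorm f.
  by rewrite [X in _ <= X]rnorm_opnorm; exact: opnorm_ub.
have gy_le : rnorm gy <= rnorm y.
  have [t t1 <-] := dual_re_phase g y.
  by apply: le_trans (dual_re_dual_ball _ g1) _; rewrite rnormZu.
have gT_le : dual_re g (w *: (fx *: y)) <= rnorm fx * rnorm gy.
  apply: le_trans (dual_re_unit_le _ _ w1) _.
  by rewrite dual_scale -[X in rnorm X]/(fx *: (gy : K^o)) rnormZ.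
have gG_le : dual_re g (G x) <= 1.
  rewrite (le_trans (dual_re_dual_ball _ g1))// -G1.
  exact: rnorm_opnorm_ub.
have nT := rnorm_tensor_ge f y0.
move: gx; rewrite [_ x](_ : _ = G x + w *: (fx *: y))// dual_reDr => gx.
rewrite [_ x](_ : _ = G x + w *: (fx *: y))// in hx.
have fg : rnorm fx * rnorm gy <= rnorm f * rnorm y.
  by rewrite ler_pM ?rnorm_ge0.
have gGx : 1 - 2 * m <= dual_re g (G x) by lra.
have fgx : rnorm f * rnorm y - 2 * m <= rnorm fx * rnorm gy by lra.
have fx_ge : rnorm f - eta <= rnorm fx.
  have : rnorm fx * rnorm gy <= rnorm fx * rnorm y.
    by rewrite ler_wpM2l ?rnorm_ge0.
  by move=> h; rewrite -(ler_pM2r y0) mulrBl; lra.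
have gy_ge : rnorm y - d <= rnorm gy.
  have : rnorm fx * rnorm gy <= rnorm f * rnorm gy.
    by rewrite ler_wpM2r ?rnorm_ge0.
  by move=> h; rewrite -(ler_pM2l f0) mulrBr; lra.
have [t t1 gty] := dual_re_phase g y.
have tg1 : rnorm (t *: g) <= 1 by rewrite rnormZu.
have tgy : rnorm y - d <= dual_re (t *: g) y by rewrite dual_re_scale gty.
have tgz := sl _ _ tg1 z1 tgy zy.
(* [x'] undoes the rotation of [g], so [t *: g] takes at [G x'] the value of [g] at [G x]; replacing
   [t *: g] by [z] costs another [e]. *)
pose x' := t^-1 *: x.
have x'1 : rnorm x' <= 1 by rewrite rnormZu//; exact: unit_scalarsV.
have [w' w'1 fx'] := dual_re_phase f x'.
exists x', w'; split=> //.
  have Gx'1 : rnorm (G x') <= 1 by rewrite -G1; exact: rnorm_opnorm_ub.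
  have := dual_re_ball (t *: g - z) Gx'1; rewrite dual_reBl.
  rewrite [X in X - _ <= _ -> _](_ : _ = dual_re g (G x)).
    by rewrite [dual_re z _](_ : _ = dual_re (adjoint G z) x')//; lra.
  rewrite dual_re_scale -linearZ /= scalerA divff ?scale1r//.
  exact: unit_scalar_neq0.
rewrite fx' dual_scale (le_trans fx_ge)// le_eqVlt; apply/orP; left; apply/eqP.
exact: (esym (rnormZu (fx : K^o) (unit_scalarsV t1))).
Qed.

Hypothesis MY : M_embedded Y.

Definition almost_spear_points (e : R) : set (dual Y) :=
  [set z | rnorm z <= 1 /\ almost_spear e (adjoint G z)].

Lemma almost_spear_points_norming (e : R) (y : Y) (d : R) : 0 < e -> 0 < d ->
  exists2 z, almost_spear_points e z & rnorm y - d <= dual_re z y.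
Proof.
move=> e0 d0; have e20 : 0 < e / 2 by lra.
suff key (y' : Y) (d' : R) : 0 < rnorm y' -> 0 < d' ->
    exists2 z, almost_spear_points e z & rnorm y' - d' <= dual_re z y'.
  have [y0|] := ltP 0 (rnorm y); first exact: key.
  move=> y0; have {y0} -> : y = 0.
    by apply: rnorm_eq0; apply/eqP; rewrite eq_le y0 rnorm_ge0.
  have [x x1 Gx] := opnorm_adherent G ltr01; rewrite G1 subrr in Gx.
  have [z Dz _] := key _ _ Gx ltr01; exists z => //.
  by rewrite (real_linear0 (dual_re_linear z)) rnorm0; lra.
move=> y'0 d'0.
(* A shift of [y'] by at most [d' / 2] is paid twice, and one by at most [rnorm y' / 2] leaves it
   nonzero. *)
have r0 : 0 < Num.min (d' / 2) (rnorm y' / 2) by rewrite lt_min; apply/andP; split; lra.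
have ny' : y' != 0 by apply/eqP => yE; rewrite yE rnorm0 ltxx in y'0.
have [y'' [c [yy c0 sl]]] := M_embedded_small_slice MY ny' r0 e20.
move: yy; rewrite le_min => /andP[yy1 yy2].
have yy3 := ler_rnormB y' y''; rewrite rnormBC in yy3.
have [z z1 zy''] := norming_functional y''.
exists z.
  split=> //; rewrite (_ : e = 2 * (e / 2)); last by field.
  apply: (small_slice_almost_spear _ c0 e20 sl) => //; [lra|rewrite zy''; lra].
have := dual_re_dual_ball (y'' - y') z1; rewrite dual_reBr; lra.
Qed.

Lemma almost_spear_points_dense (e : R) (h : dual Y) (d : R) :
  0 < e -> rnorm h <= 1 -> 0 < d ->
  exists2 c, convex_hull (almost_spear_points e) c & rnorm (h - c) <= d.
Proof.
move=> e0 h1 d0; set D := almost_spear_points e.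
have DN z : D z -> D (- z).
  move=> [z1 sz]; split; first by rewrite rnormN.
  by rewrite linearN; exact: almost_spearN.
(* [D] is symmetric: give [c] and [- c] the weights [(1 + t) / 2] and [(1 - t) / 2]. *)
have hullZ c (t : R) : 0 <= t <= 1 -> convex_hull D c ->
    convex_hull D (of_real k t *: c).
  move=> t01 Dc; have Dc' := convex_hullN DN Dc.
  rewrite (_ : _ *: c = of_real k ((1 + t) / 2) *: c +
      of_real k (1 - (1 + t) / 2) *: - c).
    by apply: convex_hull_real_convex => //; lra.
  rewrite scalerN -scalerBl -of_realB; congr (of_real k _ *: _); by field.
have [z0 Dz0 _] := almost_spear_points_norming 0 e0 ltr01.
have [h0|h0] := eqVneq (rnorm h) 0.
  exists 0; first by rewrite -(scale0r z0) -(of_real0 R k); apply: hullZ;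
    [lra|exact: sub_convex_hull].
  by rewrite subr0 h0 ltW.
have hp : 0 < rnorm h by rewrite lt_neqAle eq_sym h0 rnorm_ge0.
pose h' := of_real k (rnorm h)^-1 *: h.
have h'1 : rnorm h' = 1 by rewrite rnormZr gtr0_norm ?invr_gt0// mulVf.
have [c Dc hc] : exists2 c, convex_hull D c &
    forall y : Y, [set: Y] y -> rnorm y <= 1 -> dual_re (h' - c) y <= d.
  apply: M_embedded_norming_dense => //.
  - exact: convex_hull_real_convex.
  - apply: (convex_hull_sub (A := [set c | rnorm c <= 1])).
      exact: real_convex_ball.
    by move=> z [].
  - move=> y eps _ eps0.
    have [z Dz zy] := almost_spear_points_norming y e0 eps0; exists z => //.
    exact: sub_convex_hull.
  - by rewrite h'1.
  - move=> eps eps0; have [y y1] := dual_norm_adherent h' eps0.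
    by rewrite h'1 => hy; exists y; split=> //; exact: ltW.
exists (of_real k (rnorm h) *: c); first by apply: hullZ => //; rewrite h1 rnorm_ge0.
have {1}-> : h = of_real k (rnorm h) *: h'.
  by rewrite scalerA -of_realM mulfV// of_real1 scale1r.
rewrite -scalerBr rnormZr ger0_norm ?rnorm_ge0//.
have : rnorm (h' - c) <= d by apply: dual_norm_le => y y1; exact: hc.
have := rnorm_ge0 (h' - c); nra.
Qed.

Lemma alternative_Daugavet_lush : lush G.
Proof.
apply: lush_of_functional => // x0 y e x01 y1 e0.
have e20 : 0 < e / 2 by lra.
have [z [z1 sz] zy] := almost_spear_points_norming y e0 e20.
exists z; split=> //; first by lra.
exact: (almost_spear_aconv sz x01 e0).
Qed.

End alternative_Daugavet.

(** * Lushness of the adjoint *)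

Section convex_combinations.
Context (R : realType) (k : scalar_kind) (X : normedModType (scalars R k)).

(** The point [a] carries the missing weight, and the induction merges the head of the list into
    it. *)
Lemma real_convex_sum (I : eqType) (A : set X) (r : seq I) (t : I -> R)
    (x : I -> X) (a : X) : real_convex A -> A a ->
  (forall i, A (x i)) -> (forall i, 0 <= t i) -> \sum_(i <- r) t i <= 1 ->
  A (\sum_(i <- r) of_real k (t i) *: x i +
     of_real k (1 - \sum_(i <- r) t i) *: a).
Proof.
move=> cA Aa Ax t0; elim: r a Aa => [|i r IH] a Aa.
  by rewrite !big_nil subr0 of_real1 scale1r add0r.
rewrite !big_cons; set s := \sum_(j <- r) t j in IH *; move=> ts.
have ti := t0 i; have [s1|s1] := eqVneq s 1.
  have ti0 : t i = 0 by lra.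
  by rewrite ti0 of_real0 scale0r !add0r; apply: IH => //; lra.
have {}s1 : 0 < 1 - s by rewrite subr_gt0 lt_neqAle s1; lra.
have Ab : A (of_real k (t i / (1 - s)) *: x i +
    of_real k (1 - t i / (1 - s)) *: a).
  apply: cA => //; rewrite divr_ge0 ?(ltW s1)//= ler_pdivrMr// mul1r; lra.
have s_le1 : s <= 1 by lra.
have := IH _ Ab s_le1.
rewrite scalerDr !scalerA -!of_realM.
have -> : (1 - s) * (t i / (1 - s)) = t i by rewrite mulrC divfK// gt_eqF.
have -> : (1 - s) * (1 - t i / (1 - s)) = 1 - (t i + s).
  by rewrite mulrBr mulr1 [_ * (t i / _)]mulrC divfK ?gt_eqF//; lra.
by rewrite addrCA addrA.
Qed.

Lemma convex_hull_finite (A : set X) (c : X) : convex_hull A c ->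
  exists2 l : seq X, {in l, forall x, A x} & convex_hull [set` l] c.
Proof.
apply: (convex_hull_sub (A := [set c | exists2 l : seq X,
  {in l, forall x, A x} & convex_hull [set` l] c])).
  move=> t x y t01 [l lA lx] [m mA my]; exists (l ++ m).
    by move=> z; rewrite mem_cat => /orP[/lA|/mA].
  apply: convex_hull_real_convex => //.
    by apply: convex_hull_mono lx => z /=; rewrite mem_cat => ->.
  by apply: convex_hull_mono my => z /=; rewrite mem_cat orbC => ->.
move=> x Ax; exists [:: x]; first by move=> z; rewrite inE => /eqP->.
by apply: sub_convex_hull; rewrite /= inE.
Qed.

End convex_combinations.

Section adjoint_lush.
Context (R : realType) (k : scalar_kind).

(* Induction on [l]: replace [f] by [f + t w u] for the head [u] of [l], a
   suitable rotation [w] and a small [t > 0]. *)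
Lemma almost_spear_seq (X : normedModType (scalars R k)) (e e' : R)
    (l : seq (dual X)) : 0 <= e -> 0 < e' ->
  {in l, forall u, rnorm u <= 1 /\ almost_spear e u} ->
  forall (f : dual X) (d : R), 0 < d -> exists x, [/\ rnorm x <= 1,
    rnorm f - d <= dual_re f x &
    {in l, forall u, exists2 w, unit_scalars R k w &
       1 - e - e' <= dual_re u (w *: x)}].
Proof.
move=> e0 e'0; elim: l => [|u l IH] lP f d d0.
  have [x x1 fx] := dual_norm_adherent f d0.
  by exists x; split=> //; exact: ltW.
have [u1 su] := lP u (mem_head _ _).
have {}IH := IH (fun v vl => lP v (mem_behead (s := u :: l) vl)).
(* The point [x'] below gives [f' x' >= rnorm f - 2 * c + t * (1 - e)]. Subtracting [t u <= t] costs
   [f] at most [t * e + 2 * c <= d]; subtracting [f x' <= rnorm f] leaves [u] at least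
   [1 - e - e']. *)
pose t := d / (2 * (e + 1)); have t0 : 0 < t by rewrite divr_gt0//; lra.
have te : t * (2 * (e + 1)) = d by rewrite divfK// gt_eqF//; lra.
pose c := Num.min (t * e' / 2) (d / 4).
have te'0 : 0 < t * e' by rewrite mulr_gt0.
have c0 : 0 < c by rewrite lt_min; apply/andP; split; lra.
have c1 : c <= t * e' / 2 by rewrite ge_min lexx.
have c2 : c <= d / 4 by rewrite ge_min lexx orbT.
have [x [w [x1 w1 ux fx]]] := su f _ c0.
have wV := unit_scalarsV w1.
pose f' := f + of_real k t *: (w^-1 *: u).
have f'n : rnorm f - c + t * (1 - e) <= rnorm f'.
  have wx1 : rnorm (w *: x) <= 1 by rewrite rnormZu.
  apply: le_trans (dual_re_ball f' wx1).
  rewrite dual_reDl dual_reZl dual_re_scale scalerA mulVf ?unit_scalar_neq0//.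
  rewrite scale1r; by apply: lerD => //; rewrite ler_wpM2l// ltW.
have [x' [x'1 f'x' lx']] := IH f' _ c0.
have ux'1 : dual_re u (w^-1 *: x') <= 1.
  by apply: le_trans (dual_re_ball _ _) u1; rewrite rnormZu.
have fx'1 := dual_re_ball f x'1.
move: f'x'; rewrite dual_reDl dual_reZl dual_re_scale => f'x'.
have tux'1 : t * dual_re u (w^-1 *: x') <= t by rewrite -[leRHS]mulr1 ler_wpM2l// ltW.
exists x'; split=> //; first by lra.
move=> v; rewrite inE => /orP[/eqP->|/lx'//]; exists w^-1 => //.
rewrite -(ler_pM2l t0); lra.
Qed.

(** [h] is close to a convex combination [c] of finitely many almost spear points. One [x] almost
    norms [v] and, up to rotations, is large on all their images under the adjoint; [x], seen in the
    bidual, is the functional of the criterion. *)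
Lemma adjoint_lush (X : normedModType (scalars R k))
    (Y : completeNormedModType (scalars R k)) (G : 'L(X, Y)) :
  M_embedded Y -> rnorm G = 1 -> alternative_Daugavet G -> lush (adjoint G).
Proof.
move=> MY G1 aG; apply: lush_of_functional; first by rewrite rnorm_adjoint.
move=> h v e h1 v1 e0; have e30 : 0 < e / 3 by lra.
have [c Dc hc] := almost_spear_points_dense G1 aG MY e30 h1 e0.
have [l lD lc] := convex_hull_finite Dc.
have [|x [x1 vx lx]] := @almost_spear_seq _ (e / 3) (e / 3)
    [seq adjoint G z | z <- l] (ltW e30) e30 _ v _ e30.
  move=> _ /mapP[z zl ->]; have [z1 sz] := lD _ zl; split=> //.
  by apply: le_trans z1; rewrite -[leRHS]mul1r -G1 -rnorm_adjoint rnorm_opnorm;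
    exact: rnorm_operator.
exists (canonical_inclusion X x); split.
- by rewrite rnorm_canonical_inclusion.
- have -> : dual_re (canonical_inclusion X x) v = dual_re v x by [].
  by move: vx; rewrite v1; lra.
exists c => //; apply: convex_hull_sub lc; first exact: convex_hull_real_convex.
move=> z /= zl; have [w w1 zw] := lx _ (map_f (adjoint G) zl).
rewrite -[z]scale1r -(mulVf (unit_scalar_neq0 w1)) -scalerA.
apply: sub_aconv; first exact: unit_scalarsV.
split; first by rewrite rnormZu//; exact: (lD _ zl).1.
have -> : dual_re (canonical_inclusion X x) (adjoint G (w *: z)) =
    dual_re (adjoint G z) (w *: x).
  by rewrite linearZ -dual_re_scale.
by move: zw; lra.
Qed.

End adjoint_lush.

(** * The biadjoint *)

Section scalar_net.
Context (R : realType).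

Lemma finite_cells (T : Type) (D : set T) (I : finType) (cell : T -> I) :
  D !=set0 -> exists w : I -> T, (forall i, D (w i)) /\
    forall x, D x -> cell (w (cell x)) = cell x.
Proof.
move=> [x0 Dx0].
have /choice[w wP] : forall i, exists x, D x /\ ((exists2 y, D y & cell y = i) ->
    cell x = i).
  move=> i; have [[y Dy yi]|ny] := pselect (exists2 y, D y & cell y = i).
    by exists y.
  by exists x0.
exists w; split=> [i|x Dx]; first exact: (wP i).1.
by apply: (wP (cell x)).2; exists x.
Qed.

Lemma unit_scalars_i : unit_scalars R ComplexScalars (Complex 0 1).
Proof.
by rewrite /unit_scalars /= normc_def /= expr0n expr1n add0r sqrtr1.
Qed.

Lemma rnorm_complex_le (a b : R) :
  rnorm (Complex a b : (scalars R ComplexScalars)^o) <= `|a| + `|b|.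
Proof.
have -> : (Complex a b : (scalars R ComplexScalars)^o) =
    of_real ComplexScalars a *: (1 : (scalars R ComplexScalars)^o) +
    of_real ComplexScalars b *: (Complex 0 1 : (scalars R ComplexScalars)^o).
  apply/eqP; rewrite eq_complex /=.
  by rewrite !(mul0r, mul1r, mulr0, mulr1, add0r, addr0, subr0, sub0r, oppr0) !eqxx.
apply: le_trans (ler_rnormD _ _) _; rewrite !rnormZr.
by rewrite !rnorm_unit_scalar ?mulr1//; [exact: unit_scalars_i|exact: unit_scalars1].
Qed.

Lemma unit_scalars_net (k : scalar_kind) (d : R) : 0 < d ->
  exists (I : finType) (w : I -> scalars R k),
    (forall i, unit_scalars R k (w i)) /\
    forall z, unit_scalars R k z ->
      exists i, rnorm (z - w i : (scalars R k)^o) <= d.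
Proof.
move=> d0; case: k => /=.
  exists bool, (fun b => if b then 1 else -1); split.
    by case; rewrite /unit_scalars /= ?normrN normr1.
  move=> z z1; have : `|z| == 1 by rewrite z1.
  rewrite eqr_norml ler01 andbT => /orP[|] /eqP->; [exists true|exists false].
    by rewrite /rnorm subrr normr0 /= ltW.
  by rewrite /rnorm opprK addNr normr0 /= ltW.
pose N := Num.bound (2 / d).
have dN : 2 < N%:R * d.
  by rewrite -ltr_pdivrMr//; apply: archi_boundP; rewrite divr_ge0// ltW.
(* On the interval from -1 to 1 the truncation takes the values 0 to [2 * N], the last only at 1; a
   cell has side [1 / N <= d / 2]. *)
pose q (a : R) : 'I_(2 * N).+1 := inord (Num.trunc ((a + 1) * N%:R)).
pose cell (z : R[i]) := (q (complex.Re z), q (complex.Im z)).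
have [|w [w1 wcell]] := @finite_cells _ (unit_scalars R ComplexScalars) _ cell.
  by exists 1; exact: unit_scalars1.
exists _, w; split=> // z z1; exists (cell z).
have qP (a b : R) : `|a| <= 1 -> `|b| <= 1 -> q a = q b -> `|a - b| <= d / 2.
  move=> a1 b1.
  have N0 : 0 < (N%:R : R) by move: d0 dN; nra.
  have bnd (c : R) : `|c| <= 1 -> 0 <= (c + 1) * N%:R /\
      (Num.trunc ((c + 1) * N%:R) < (2 * N).+1)%N.
    rewrite ler_norml => /andP[c1 c2].
    have c0 : 0 <= (c + 1) * N%:R by rewrite mulr_ge0 ?(ltW N0)//; lra.
    split=> //; rewrite ltnS -(ler_nat R) natrM.
    have /andP[h _] := truncn_itv c0; apply: le_trans h _.
    by rewrite ler_wpM2r ?(ltW N0)//; lra.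
  have [a0 aN] := bnd _ a1; have [b0 bN] := bnd _ b1.
  move=> /(congr1 val); rewrite /= !inordK// => tab.
  have /andP[ha1 ha2] := truncn_itv a0; have /andP[hb1 hb2] := truncn_itv b0.
  rewrite tab -natr1 in ha1 ha2; rewrite -natr1 in hb2.
  have : `|(a - b) * N%:R| <= 1 by rewrite ler_norml; apply/andP; split; lra.
  rewrite normrM (gtr0_norm N0) => h; rewrite -(ler_pM2r N0); lra.
have re_im (x : R[i]) : unit_scalars R ComplexScalars x ->
    `|complex.Re x| <= 1 /\ `|complex.Im x| <= 1.
  move=> x1; have ix1 := rnormZu (x : (scalars R ComplexScalars)^o) unit_scalars_i.
  have x1' := rnorm_unit_scalar x1; split.
    by rewrite -x1'; exact: (@ler_norm_real_part R ComplexScalars).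
  rewrite -x1' -ix1; apply: le_trans (@ler_norm_real_part R ComplexScalars _).
  by case: x {x1 ix1 x1'} => a b; rewrite /= mul0r mul1r sub0r normrN.
have [z2 z3] := re_im _ z1; have [w2 w3] := re_im _ (w1 (cell z)).
have [cE1 cE2] := wcell _ z1.
case: z (w (cell z)) {z1} z2 z3 w2 w3 cE1 cE2 => a b [a' b'] /= z2 z3 w2 w3 cE1 cE2.
apply: le_trans (rnorm_complex_le _ _) _.
have := qP _ _ z2 w2 (esym cE1); have := qP _ _ z3 w3 (esym cE2); lra.
Qed.

End scalar_net.

Section bidual_slice.
Context (R : realType) (k : scalar_kind) (X : normedModType (scalars R k)).
Local Notation K := (scalars R k).

(* Let [F] be the slice of the ball of [X] where [u] is large.  The unit scalars
   have a finite [d]-net [w i], so the functional [p0] is dominated by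
   [f |-> sup_i sup_F (w i f) + d |f|].  Hahn-Banach on families [(f i, r i)_i]
   of pairs in [X* * K], together with a last entry in [X*] for the error term,
   decomposes [p0] as a convex combination of rotated elements of the slice of
   the bidual ball, up to [d]; the entries [r i] provide the coefficients. *)
Lemma almost_spear_bidual_aconv (e : R) (u : dual X) (p0 : dual (dual X)) (d : R) :
  almost_spear e u -> rnorm p0 <= 1 -> 0 < d ->
  exists2 c, aconv [set p : dual (dual X) | rnorm p <= 1 /\ 1 - e <= dual_re p u] c &
    rnorm (p0 - c) <= d.
Proof.
move=> su p01 d0; set A := [set p | _].
have [I [w [w1 wnet]]] := @unit_scalars_net R k d d0.
pose F := [set x : X | rnorm x <= 1 /\ 1 - e <= dual_re u x].
have [x0 Fx0] : F !=set0.
  by have [x [_ [x1 _ ux _]]] := su 0 _ ltr01; exists x.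
have [i0 _] := wnet _ (unit_scalars1 R k).
pose V : lmodType K := ((I -> dual X * K^o) * dual X)%type.
(* A pair [(f, r)] acts as the affine function [f x + r] on [F]; constants will reveal the weights
   [lam i]. *)
pose phi (j : I * X) (v : V) : R := dual_re (v.1 j.1).1 j.2 + real_part (v.1 j.1).2.
pose B := [set j : I * X | F j.2].
have lphi j : B j -> real_linear (phi j).
  move=> _; split=> [v v'|r v]; rewrite /phi /=.
    by rewrite dual_reDl real_partD addrACA.
  by rewrite dual_reZl [real_part _]real_partZ mulrDr.
have ubphi v : has_ubound [set phi j v | j in B].
  exists (\sum_i (rnorm (v.1 i).1 + rnorm (v.1 i).2)) => _ [[i x] [x1 _] <-].
  rewrite (bigD1 i)//= -[leLHS]addr0; apply: lerD.
    by apply: lerD; [exact: dual_re_ball|exact: ler_real_part].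
  by apply: sumr_ge0 => j _; rewrite addr_ge0 ?rnorm_ge0.
pose p (v : V) := sup [set phi j v | j in B].
have sp : sublinear p by apply: sublinear_sup => //; exists (i0, x0).
have ple v c : (forall i x, F x -> phi (i, x) v <= c) -> p v <= c.
  move=> h; apply: ge_sup; first by exists (phi (i0, x0) v), (i0, x0).
  by move=> _ [[i x] Fx <-]; exact: h.
have lep v i x : F x -> phi (i, x) v <= p v.
  by move=> Fx; apply: ub_le_sup => //; exists (i, x).
pose P (v : V) := p v + d * rnorm v.2.
have sP : sublinear P.
  have [nD nZ] := @sublinear_rnorm R k (dual X) d (ltW d0).
  split=> [v v'|r v r0]; rewrite /P.
    by have := sp.1 v v'; have := nD v.2 v'.2; rewrite /=; lra.
  by rewrite sp.2//= nZ// mulrDr.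
pose diag (f : dual X) : V := (fun i => (w i *: f, 0), f).
have diagD f g : diag (f + g) = diag f + diag g.
  by congr (_, _); apply/funext => i; congr (_, _); rewrite /= ?scalerDr ?addr0.
have diagZ (r : R) f : diag (of_real k r *: f) = of_real k r *: diag f.
  congr (_, _); apply/funext => i; congr (_, _).
    by rewrite /= !scalerA mulrC.
  exact: (esym (scaler0 _ _)).
pose C := [set (diag f, dual_re p0 f) | f in [set: dual X]].
have cC : convex_cone C.
  split.
  - exists 0 => //; rewrite real_linear0; last exact: dual_re_linear.
    by rewrite -(scale0r 0) -(of_real0 R k) diagZ of_real0 scale0r.
  - by move=> _ _ [f _ <-] [g _ <-]; exists (f + g); rewrite // diagD dual_reDr.
  - move=> r _ _ [f _ <-]; exists (of_real k r *: f); first by [].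
    by rewrite diagZ dual_reZr.
(* [f] is almost normed by some [z *: x] with [x] in [F], and replacing [z] by a net point costs at
   most [d * rnorm f]. *)
have [|L [lL LP LC]] := mazur_orlicz sP cC.
  move=> _ [f _ <-] /=; apply/ler_addgt0Pr => eps eps0.
  have [x [z [x1 z1 ux fx]]] := su f _ eps0.
  have [i zi] := wnet _ z1.
  have := lep (diag f) i x (conj x1 ux).
  rewrite /phi /= [real_part _](_ : _ = 0); last by rewrite /real_part; case: (k).
  rewrite addr0 dual_re_scale /P /=.
  have := dual_re_le f ((z - w i) *: x); rewrite scalerBl dual_reBr -scalerBl rnormZ.
  have := dual_re_dual_ball f p01.
  have : rnorm f * (rnorm (z - w i : K^o) * rnorm x) <= d * rnorm f.
    rewrite mulrC ler_wpM2r ?rnorm_ge0//.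
    by have := rnorm_ge0 (z - w i : K^o); have := rnorm_ge0 x; nra.
  lra.
pose inj i (a : dual X * K^o) : V := (fun j => if j == i then a else 0, 0).
have injD i a b : inj i (a + b) = inj i a + inj i b.
  congr (_, _); last by rewrite addr0.
  by apply/funext => j /=; rewrite fctE /=; case: eqP; rewrite ?addr0.
have injZ i (r : R) a : inj i (of_real k r *: a) = of_real k r *: inj i a.
  congr (_, _); last by rewrite scaler0.
  by apply/funext => j /=; rewrite fctE /=; case: eqP; rewrite ?scaler0.
(* The other entries are zero and contribute 0 to the supremum. *)
have Linj i f (r : R) : (forall x, F x -> dual_re f x + r <= 0) ->
    L (inj i (f, of_real k r)) <= 0.
  move=> h; apply: le_trans (LP _) _.
  rewrite /P /= rnorm0 mulr0 addr0; apply: ple => j x Fx.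
  rewrite /phi /=; case: eqP => _ /=; first by rewrite of_realK; exact: h.
  by rewrite dual_re0l add0r /real_part; case: (k).
pose lam i := L (inj i (0, 1)).
pose Li i f := L (inj i (f, 0)).
have LiE i f (r : R) : L (inj i (f, of_real k r)) = Li i f + r * lam i.
  rewrite /Li /lam -lL.2 -injZ -lL.1 -injD; congr (L (inj i _)).
  congr (_, _); first by rewrite /= scaler0 addr0.
  by rewrite /= add0r [_ *: 1]mulr1.
have Li_lin i : real_linear (Li i).
  split=> [f g|r f].
    by rewrite /Li -lL.1 -injD; congr (L (inj i (_, _))); rewrite /= addr0.
  by rewrite /Li -lL.2 -injZ; congr (L (inj i (_, _))); rewrite /= scaler0.
have lam0 i : 0 <= lam i.
  have := @Linj i 0 (-1); rewrite LiE real_linear0// add0r mulN1r => h.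
  rewrite -oppr_le0; apply: h => x _; rewrite dual_re0l; lra.
have Li_le i f : Li i f <= lam i * rnorm f.
  have := @Linj i f (- rnorm f); rewrite LiE mulNr subr_le0 mulrC; apply.
  by move=> x [x1 _]; rewrite subr_le0; exact: dual_re_ball.
have Li_u i : lam i * (1 - e) <= Li i u.
  suff : L (inj i (- u, of_real k (1 - e))) <= 0.
    by rewrite LiE real_linearN//; lra.
  by apply: Linj => x [_ ux]; rewrite dual_reNl; lra.
have sumL (g : I -> dual X * K^o) : L (g, 0) = \sum_i L (inj i (g i)).
  rewrite -(big_morph L lL.1 (real_linear0 lL)); congr L.
  rewrite [RHS]surjective_pairing; congr (_, _).
    rewrite (big_morph fst (fun _ _ => erefl) erefl) /= fct_sumE.
    by apply/funext => j; rewrite -big_mkcond /= (big_pred1 j).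
  by rewrite (big_morph snd (fun _ _ => erefl) erefl) big1.
(* Putting the constant 1, then -1, in every entry gives the two inequalities. *)
have lam1 : \sum_i lam i = 1.
  have Lc (r : R) : L (fun=> (0, of_real k r), 0) <= r.
    apply: le_trans (LP _) _; rewrite /P /= rnorm0 mulr0 addr0.
    by apply: ple => i x Fx; rewrite /phi /= dual_re0l of_realK add0r.
  have LcE (r : R) : L (fun=> (0, of_real k r), 0) = r * \sum_i lam i.
    rewrite (sumL (fun=> (0, of_real k r))) mulr_sumr; apply: eq_bigr => i _.
    by rewrite LiE real_linear0// add0r.
  have := Lc 1; have := Lc (-1); rewrite !LcE; lra.
(* Zero weight forces [Li i = 0], and any element of [A] will do; otherwise divide by the weight. *)
have /choice[psi psiP] : forall i, exists q,
    A q /\ forall f, Li i f = lam i * dual_re q f.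
  move=> i; have [l0|l0] := eqVneq (lam i) 0.
    exists (canonical_inclusion X x0); split.
      by split; [rewrite rnorm_canonical_inclusion; exact: Fx0.1|exact: Fx0.2].
    move=> f; rewrite l0 mul0r; have := Li_le i f; have := Li_le i (- f).
    rewrite l0 !mul0r real_linearN//; lra.
  have lp : 0 < lam i by rewrite lt_neqAle eq_sym l0 lam0.
  have lq : real_linear (fun f => (lam i)^-1 * Li i f).
    split=> [f g|r f]; first by rewrite (Li_lin i).1 mulrDr.
    by rewrite (Li_lin i).2 mulrCA.
  have [|q q1 qE] := dual_of_real_linear ler01 lq.
    by move=> f; rewrite mul1r ler_pdivrMl//.
  exists q; split; last by move=> f; rewrite qE mulVKf.
  by split; rewrite // qE ler_pdivlMl.
exists (\sum_i of_real k (lam i) *: (w i *: psi i)).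
  have := @real_convex_sum _ _ _ _ (aconv A) (index_enum I) lam
    (fun i => w i *: psi i) (w i0 *: psi i0) (@convex_hull_real_convex _ _ _ _).
  rewrite lam1 subrr of_real0 scale0r addr0; apply=> // [|i].
    by apply: sub_aconv => //; exact: (psiP i0).1.
  by apply: sub_aconv => //; exact: (psiP i).1.
have sum_re (f : dual X) :
    dual_re (\sum_i of_real k (lam i) *: (w i *: psi i)) f = \sum_i Li i (w i *: f).
  rewrite (big_morph (fun q : dual (dual X) => dual_re q f) (id1 := 0) (op1 := +%R)) //.
  - apply: eq_bigr => i _.
    by rewrite dual_reZl dual_re_scale (psiP i).2.
  - by move=> q q'; exact: dual_reDl.
  - exact: dual_re0l.
(* [p0 f <= L (diag f)], the indexed entries of [diag f] account for the combination, and the last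
   one for [L (0, f) <= d]. *)
apply: dual_norm_le => f f1; rewrite dual_reBl sum_re.
have : L (0, f) <= d.
  apply: le_trans (LP _) _; rewrite /P /=.
  have : p (0, f) <= 0.
    apply: ple => i x _; rewrite /phi /= dual_re0l add0r.
    by rewrite /real_part; case: (k).
  by have := rnorm_ge0 f; nra.
have := LC (diag f, dual_re p0 f) (ex_intro2 _ _ f Logic.I erefl) => /=.
have -> : diag f = ((fun i => (w i *: f, 0)) : I -> dual X * K^o, 0) + (0, f) :> V.
  by congr (_, _); [apply/funext => i; rewrite fctE /= addr0|rewrite add0r].
rewrite lL.1 sumL /Li /=; lra.
Qed.

End bidual_slice.

Section equivalences.
Context (R : realType) (k : scalar_kind).
Context (X : normedModType (scalars R k)) (Y : completeNormedModType (scalars R k)).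

(** Some almost spear point [z] almost norms [y], since a point of their convex hull does; the slice
    of the bidual ball given by [adjoint G z] then meets the criterion. *)
Lemma adjoint_adjoint_lush (G : 'L(X, Y)) :
  M_embedded Y -> rnorm G = 1 -> alternative_Daugavet G ->
  lush (adjoint (adjoint G)).
Proof.
move=> MY G1 aG; apply: lush_of_functional; first by rewrite !rnorm_adjoint.
move=> p0 y e p01 y1 e0; have e40 : 0 < e / 4 by lra.
have [h h1 yh] := dual_norm_adherent y e40.
have [c Dc hc] := almost_spear_points_dense G1 aG MY e0 h1 e40.
have yc : 1 - e / 2 < dual_re y c.
  have := dual_re_le y (h - c); rewrite dual_reBr y1 mul1r; lra.
have [z Dz yz] : exists2 z, almost_spear_points G e z & 1 - e < dual_re y z.
  apply: contrapT => nz.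
  have : convex_hull (almost_spear_points G e) `<=`
      [set z | - (1 - e) <= dual_re (- y) z].
    apply: convex_hull_sub; first exact/real_convex_halfspace/dual_re_linear.
    move=> z Dz /=; rewrite dual_reNl lerN2 leNgt; apply/negP => hz.
    by apply: nz; exists z.
  by move=> /(_ _ Dc) /=; rewrite dual_reNl; lra.
exists (canonical_inclusion (dual Y) z); split => //.
  by rewrite rnorm_canonical_inclusion; exact: Dz.1.
exact: (almost_spear_bidual_aconv Dz.2 p01 e0).
Qed.

End equivalences.

Theorem proposition5p21 (R : realType) (k : scalar_kind)
    (X Y : completeNormedModType (scalars R k)) (G : 'L(X, Y)) :
  M_embedded Y -> rnorm G = 1%R ->
  (alternative_Daugavet G -> lush (adjoint G)) /\
  [<-> alternative_Daugavet G;
       spear G;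
       lush G;
       alternative_Daugavet (adjoint G);
       spear (adjoint G);
       lush (adjoint G);
       alternative_Daugavet (adjoint (adjoint G));
       spear (adjoint (adjoint G));
       lush (adjoint (adjoint G))].
Proof.
move=> MY G1; have aL := adjoint_lush MY G1; split=> //.
have lA (Z W : normedModType (scalars R k)) (T : 'L(Z, W)) :
    lush T -> alternative_Daugavet T.
  by move=> /lush_spear/spear_alternative_Daugavet.
have sA (Z W : normedModType (scalars R k)) (T : 'L(Z, W)) :
    alternative_Daugavet (adjoint T) -> alternative_Daugavet T.
  exact: alternative_Daugavet_adjoint.
have aLL := adjoint_adjoint_lush MY G1.
(* The implications form a cycle: [sA] descends to [G], whose alternative Daugavet property gives
   lushness at every level. *)
tfae.
- by move=> /(alternative_Daugavet_lush G1)/(_ MY)/lush_spear.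
- by move=> /spear_alternative_Daugavet/(alternative_Daugavet_lush G1)/(_ MY).
- by move=> /lA/aL/lA.
- by move=> /sA/aL/lush_spear.
- by move=> /spear_alternative_Daugavet/sA/aL.
- by move=> /lA/sA/aLL/lA.
- by move=> /sA/sA/aLL/lush_spear.
- by move=> /spear_alternative_Daugavet/sA/sA/aLL.
- by move=> /lA/sA/sA.
Qed.
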